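(* For each integer $m \ge 1$ let $n_m = m^2$ and $$B^{(m)} = \Big\{x \in \{-1,1\}^{n_m} : \sum_{i=1}^m \Big(\frac{1}{\sqrt m} \sum_{j=(i-1)m+1}^{im} x_j\Big)^2 \le m\Big\}.$$ Then the sequence $(B^{(m)})_{m\ge1}$ is noise stable, but there is a universal constant $C$ such that $M(B^{(m)}) \le C m^{-1/200}$ for all $m$.
   Context: $\{-1,1\}^n$ carries the uniform probability measure, with respect to which $\mathbb{E}$, $\mathrm{Var}$, $\mathrm{Cov}$ are taken. For $t \ge 0$, $P_t$ is the Bonami-Beckner semigroup: for $n=1$, $(P_{t,1} f)(x) = \mathbb{E} f + e^{-t}(f(x) - \mathbb{E} f)$, and in general $P_t = P_{t,1}^{\otimes n}$. A sequence of sets $A_i \subset \{-1,1\}^{n_i}$ is noise sensitive if for every $t>0$, $\mathrm{Var}(P_t 1_{A_i}) \to 0$ as $i \to \infty$; otherwise it is called noise stable. A half-space in $\{-1,1\}^n$ is a set of the form $\{x \in \{-1,1\}^n: \langle x, a\rangle \le b\}$ with $a \in \mathbb{R}^n$, $b \in \mathbb{R}$; $\mathcal{H}_n$ is the set of all half-spaces. For $B \subset \{-1,1\}^n$, $M(B) = \sup_{A \in \mathcal{H}_n} \mathrm{Cov}(1_A, 1_B)$. *)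

(* Defs.v *)
From HB Require Import structures.
From mathcomp Require Import all_boot all_order all_algebra.
From mathcomp Require Import all_classical all_reals all_analysis.

Set Implicit Arguments.
Unset Strict Implicit.
Unset Printing Implicit Defensive.

Import Order.TTheory GRing.Theory Num.Theory.
Import numFieldNormedType.Exports.

Local Open Scope classical_set_scope.
Local Open Scope ring_scope.

(* {-1,1} is encoded by bool, through false |-> 1 and true |-> -1. *)
Definition spin (R : realType) (b : bool) : R := (-1) ^+ b.

Notation cube n := {ffun 'I_n -> bool}.

Section Uniform.
Context {R : realType} {T : finType}.
Implicit Types f g : T -> R.

Definition umean f : R := (\sum_(x : T) f x) / #|T|%:R.

Definition ucov f g : R := umean (fun x => (f x - umean f) * (g x - umean g)).

Definition uvar f : R := ucov f f.

End Uniform.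

Definition ind (R : realType) (T : finType) (A : {set T}) : T -> R :=
  fun x => (x \in A)%:R.

Section NoiseSensitivity.
Context {R : realType}.

Definition noise1 (t : R) (f : bool -> R) : bool -> R :=
  fun x => umean f + expR (- t) * (f x - umean f).

(* The n-th tensor power of an operator U on functions on {-1,1}: the linear
   operator sending the basis function delta_y = prod_i delta_{y_i} to
   prod_i U(delta_{y_i}), applied to f = sum_y f(y) delta_y. *)
Definition tensor_pow (U : (bool -> R) -> bool -> R) (n : nat)
    (f : cube n -> R) : cube n -> R :=
  fun x => \sum_(y : cube n)
    f y * \prod_(i < n) U (fun b => (b == y i)%:R) (x i).

Definition noise (t : R) (n : nat) : (cube n -> R) -> cube n -> R :=
  @tensor_pow (noise1 t) n.

Definition noise_sensitive (n : nat -> nat)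
    (A : forall i, {set cube (n i)}) : Prop :=
  forall t : R, 0 < t ->
    (fun i => uvar (noise t (ind R (A i)))) @ \oo --> (0 : R).

Definition noise_stable (n : nat -> nat)
    (A : forall i, {set cube (n i)}) : Prop :=
  ~ noise_sensitive A.

Definition halfspaces (n : nat) : set {set cube n} :=
  [set A | exists (a : 'rV[R]_n) (b : R),
     A = [set x : cube n | \sum_(i < n) spin R (x i) * a 0 i <= b]%SET].

Definition max_halfspace_cov (n : nat) (B : {set cube n}) : R :=
  sup [set ucov (ind R A) (ind R B) | A in @halfspaces n].

End NoiseSensitivity.

Arguments noise_sensitive R {n} A.
Arguments noise_stable R {n} A.
Arguments halfspaces R n : clear implicits.
Arguments max_halfspace_cov R {n} B.

(* Coordinates are numbered from 0: block i < m is i*m, ..., (i+1)*m - 1. *)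
Definition block_ball (R : realType) (m : nat) : {set cube (m ^ 2)} :=
  [set x : cube (m ^ 2) |
     \sum_(i < m)
        ((Num.sqrt (m%:R : R))^-1 *
         \sum_(j < m ^ 2 | (i * m <= j < i.+1 * m)%N) spin R (x j)) ^+ 2
     <= m%:R]%SET.

(* Main.v *)
Require Import Defs.
From HB Require Import structures.
From mathcomp Require Import all_boot all_order all_algebra.
From mathcomp Require Import all_classical all_reals all_analysis.
From mathcomp Require Import ring lra.

(** Write [W_k] for the sum of the signs in block [k], and
    [Q = \sum_k (W_k ^ 2 / m - 1)]; the ball is the event [Q <= 0].

    Stability.  [Q] is a homogeneous polynomial of degree two with mean zero, so
    that [noise t] multiplies it by [exp (- 2 t)] ([noise_qform]).  As [noise t]
    is self-adjoint, its effect on the ball has covariance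
    [exp (- 2 t) * Cov (1_B, Q)] with [Q], and [- Cov (1_B, Q)] is half the mean
    of [|Q|].  The latter is of the order of the standard deviation of [Q]
    because [Q] does not concentrate at zero ([qform_anticoncentration]), and
    the Cauchy-Schwarz inequality bounds the variance of the noisy indicator from
    below ([uvar_noise_ball]).

    Half-spaces.  Let [L = \sum_j a_j x_j] be a linear form.  The ball, and hence
    [Q], is unchanged when all the signs of a block are reversed, so [1_{L <= b}]
    may be averaged over such reversals; that makes its discrete derivatives of
    second order.  The covariance of two functions is bounded by the sum over the
    coordinates of the products of the quadratic means of their derivatives
    ([ler_norm_ucov_dif]).  Replace [1_{L <= b}] by a twice differentiable
    threshold of width [s], and [1_{Q <= 0}] by a Lipschitz threshold of width
    [t] of the part of [Q] outside a set [T] of blocks.  The covariance of the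
    replacements is at most a constant times [sigma ^ 2 / (s ^ 2 * t)], where
    [sigma ^ 2] is the sum of the [a_j ^ 2] outside [T]
    ([ucov_threshold_cutoff]).  Let [r] be a parameter with [r ^ 8 <= m], let
    [T] consist of about [r ^ 2] blocks where [a] has the largest norm, let [tau]
    be the smallest of these norms, and put [t = sqrt m / r] and
    [s = max (sigma / r, tau)].  The bound is then of order [r ^ 3 / sqrt m].
    The replacements cost the probabilities of [|L - b| <= s] and [|Q| <= t],
    and the contribution of the blocks of [T] to [Q]; all three are [O (1 / r)]
    ([halfspace_threshold], [ball_cutoff]).  The choice [r = m ^ (1 / 200)] gives
    the theorem.

    Both small-ball estimates come from one argument ([anticoncentration]).
    Let [f] be [L] or [Q], let [h] be [f - c] clamped to the interval of radius
    [3 s], and let [g] be an eigenfunction of the discrete Laplacian whose jumps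
    follow those of [f] but are at most [2 s].  The mean of [h * g] is at most
    [3 s] times the quadratic mean of [g]; summation by parts expresses it
    through the products of the jumps of [h] and [g], which are nonnegative, and
    at least the squared jumps of [g] wherever [|f - c| <= s]. *)

Set Implicit Arguments.
Unset Strict Implicit.
Unset Printing Implicit Defensive.

Import Order.TTheory GRing.Theory Num.Theory.
Import numFieldNormedType.Exports.

Local Open Scope ring_scope.

(** * Uniform means *)

Lemma natb_itv (R : realType) (c : bool) : 0 <= (c%:R : R) <= 1.
Proof. by case: c; rewrite ?lexx ?ler01. Qed.

Section Mean.
Context {R : realType} {T : finType}.
Implicit Types f g : T -> R.

Lemma eq_umean f g : f =1 g -> umean f = umean g.
Proof. by move=> fg; rewrite /umean; under eq_bigr do rewrite fg. Qed.

Lemma umeanD f g : umean (fun x => f x + g x) = umean f + umean g.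
Proof. by rewrite /umean big_split mulrDl. Qed.

Lemma umeanZ c f : umean (fun x => c * f x) = c * umean f.
Proof. by rewrite /umean -mulr_sumr mulrA. Qed.

Lemma umeanN f : umean (fun x => - f x) = - umean f.
Proof. by rewrite /umean sumrN mulNr. Qed.

Lemma umeanB f g : umean (fun x => f x - g x) = umean f - umean g.
Proof. by rewrite umeanD umeanN. Qed.

Lemma umean_sum (I : finType) (P : pred I) (F : I -> T -> R) :
  umean (fun x => \sum_(i | P i) F i x) = \sum_(i | P i) umean (F i).
Proof. by rewrite /umean exchange_big mulr_suml. Qed.

Lemma ler_umean f g : (forall x, f x <= g x) -> umean f <= umean g.
Proof.
by move=> fg; rewrite ler_wpM2r ?invr_ge0 ?ler0n//; apply: ler_sum => x _.
Qed.

Lemma umean_ge0 f : (forall x, 0 <= f x) -> 0 <= umean f.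
Proof.
by move=> f0; rewrite mulr_ge0 ?invr_ge0 ?ler0n//; apply: sumr_ge0 => x _.
Qed.

Lemma ler_norm_umean f : `|umean f| <= umean (fun x => `|f x|).
Proof.
by rewrite normrM normfV normr_nat ler_wpM2r ?invr_ge0 ?ler0n// ler_norm_sum.
Qed.

Lemma umean_bij (s : T -> T) f : bijective s -> umean (fun x => f (s x)) = umean f.
Proof. by move=> s_bij; rewrite /umean [in RHS](reindex s)//; exact: onW_bij. Qed.

Lemma umean_CauchySchwarz f g :
  umean (fun x => f x * g x) ^+ 2
    <= umean (fun x => f x ^+ 2) * umean (fun x => g x ^+ 2).
Proof.
set a := umean (fun x => f x ^+ 2); set b := umean (fun x => g x ^+ 2).
set c := umean _.
have quad u v : 0 <= u ^+ 2 * a + v ^+ 2 * b + (2 * u * v) * c.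
  rewrite -!umeanZ -!umeanD; apply: umean_ge0 => x.
  have -> : u ^+ 2 * f x ^+ 2 + v ^+ 2 * g x ^+ 2 + (2 * u * v) * (f x * g x)
    = (u * f x + v * g x) ^+ 2 by ring.
  exact: sqr_ge0.
have b0 : 0 <= b by apply: umean_ge0 => x; exact: sqr_ge0.
case: (eqVneq b 0) => [b_eq0|b_neq0].
  have := quad c (- (a + 1) / 2).
  have a0 : 0 <= a by apply: umean_ge0 => x; exact: sqr_ge0.
  rewrite b_eq0 mulr0 addr0 => h.
  have -> : a * 0 = 0 by rewrite mulr0.
  suff : c ^+ 2 <= 0 by [].
  move: h; have -> : c ^+ 2 * a + 2 * c * (- (a + 1) / 2) * c = - c ^+ 2 by field.
  by rewrite oppr_ge0.
have b_gt0 : 0 < b by rewrite lt_neqAle eq_sym b_neq0.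
have := quad b (- c).
have -> : b ^+ 2 * a + (- c) ^+ 2 * b + 2 * b * - c * c = b * (a * b - c ^+ 2) by ring.
by rewrite pmulr_rge0// subr_ge0.
Qed.

Lemma ler_norm_umeanM f g (A B : R) : 0 <= A -> 0 <= B ->
  umean (fun x => f x ^+ 2) <= A ^+ 2 -> umean (fun x => g x ^+ 2) <= B ^+ 2 ->
  `|umean (fun x => f x * g x)| <= A * B.
Proof.
move=> A0 B0 fA gB.
rewrite -(ler_pXn2r (n := 2)) ?nnegrE ?mulr_ge0// real_normK ?num_real//.
apply: le_trans (umean_CauchySchwarz f g) _; rewrite exprMn.
by apply: ler_pM => //; apply: umean_ge0 => x; exact: sqr_ge0.
Qed.

Context (T_gt0 : (0 < #|T|)%N).

Lemma umean_cst (c : R) : umean (fun _ : T => c) = c.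
Proof. by rewrite /umean sumr_const -[c *+ _]mulr_natr mulfK// pnatr_eq0 -lt0n. Qed.

Lemma ler_norm_umean1 f (A : R) : 0 <= A ->
  umean (fun x => f x ^+ 2) <= A ^+ 2 -> umean (fun x => `|f x|) <= A.
Proof.
move=> A0 fA; have := @ler_norm_umeanM (fun x => `|f x|) (fun=> 1) A 1 A0 ler01.
rewrite !mulr1 expr1n (umean_cst 1) lexx.
under eq_umean do rewrite real_normK ?num_real//.
under [X in `|X| <= _]eq_umean do rewrite mulr1.
by move=> /(_ fA isT); rewrite ger0_norm// umean_ge0.
Qed.

Lemma ucovE f g : ucov f g = umean (fun x => f x * g x) - umean f * umean g.
Proof.
rewrite /ucov; set a := umean f; set b := umean g.
transitivity (umean (fun x => f x * g x - (b * f x + a * g x - a * b))).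
  by apply: eq_umean => x; ring.
rewrite umeanB umeanB umeanD !umeanZ umean_cst -/a -/b. 
rewrite -/(umean g) -/b; ring.
Qed.

Lemma ucovC f g : ucov f g = ucov g f.
Proof. by rewrite /ucov; apply: eq_umean => x; rewrite mulrC. Qed.

Lemma ucovBl f1 f2 g : ucov f1 g = ucov (fun x => f1 x - f2 x) g + ucov f2 g.
Proof.
rewrite !ucovE (eq_umean (f := fun x => (f1 x - f2 x) * g x) (fun x => mulrBl _ _ _)).
by rewrite !umeanB; ring.
Qed.

(** Centring a function with values in the unit interval leaves it bounded by
    one, so that the constant is 1 and not 2. *)
Lemma ler_norm_ucov f g : (forall x, 0 <= g x <= 1) ->
  `|ucov f g| <= umean (fun x => `|f x|).
Proof.
move=> g01; have Eg : 0 <= umean g <= 1.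
  rewrite umean_ge0 => [|x]; last by case/andP: (g01 x).
  by rewrite -(umean_cst 1) ler_umean// => x; case/andP: (g01 x).
have -> : ucov f g = umean (fun x => f x * (g x - umean g)).
  transitivity (umean (fun x => f x * g x - umean g * f x)).
    by rewrite ucovE umeanB umeanZ mulrC.
  by apply: eq_umean => x; ring.
apply: le_trans (ler_norm_umean _) _; apply: ler_umean => x.
rewrite normrM ler_piMr// ler_norml.
by move: (g01 x) Eg => /andP[? ?] /andP[? ?]; lra.
Qed.

End Mean.

(** * Flipping coordinates *)

Section Flips.
Context {R : realType} {I : finType}.
Local Notation X := {ffun I -> bool}.
Implicit Types (f g F G H : X -> R) (x u : X) (i j : I).

Lemma card_cube_gt0 : (0 < #|X|)%N.
Proof. by apply/card_gt0P; exists [ffun=> false]. Qed.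
Local Hint Resolve card_cube_gt0 : core.

(** The cube acts on itself: [flips u] reverses the signs of the coordinates
    where [u] is true.  Single flips, reversals of a block and the identity are
    all of this form, so they commute and preserve the mean. *)
Definition flips u x : X := [ffun i => x i (+) u i].

Definition flip j : X -> X := flips [ffun i => i == j].

Definition dif j f x : R := f x - f (flip j x).

Lemma flipsK u : involutive (flips u).
Proof. by move=> x; apply/ffunP => i; rewrite !ffunE addbK. Qed.

Lemma flipsC u v x : flips u (flips v x) = flips v (flips u x).
Proof. by apply/ffunP => i; rewrite !ffunE addbAC. Qed.

Lemma flipE j x i : flip j x i = x i (+) (i == j).
Proof. by rewrite !ffunE. Qed.

Lemma umean_flips u f : umean (fun x => f (flips u x)) = umean f.
Proof. by apply: umean_bij; exists (flips u); exact: flipsK. Qed.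

Lemma umean_dif j f : umean (dif j f) = 0.
Proof. by rewrite umeanB umean_flips subrr. Qed.

Lemma dif_flip j f x : dif j f (flip j x) = - dif j f x.
Proof. by rewrite /dif /flip flipsK opprB. Qed.

(** Summation by parts: [dif j g] is odd under the flip of [j], so only the odd
    part of [f], which is [dif j f / 2], contributes. *)
Lemma umean_mul_dif j f g :
  umean (fun x => f x * dif j g x) = 2^-1 * umean (fun x => dif j f x * dif j g x).
Proof.
have e : umean (fun x => f (flip j x) * dif j g x) = - umean (fun x => f x * dif j g x).
  rewrite -(umean_flips [ffun i => i == j] (fun x => f x * dif j g x)) -umeanN.
  by apply: eq_umean => x; rewrite dif_flip mulrN opprK.
have -> : umean (fun x => dif j f x * dif j g x) =
  umean (fun x => f x * dif j g x) - umean (fun x => f (flip j x) * dif j g x).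
  by rewrite -umeanB; apply: eq_umean => x; rewrite mulrBl.
by rewrite e opprK; field.
Qed.

End Flips.
#[global] Hint Resolve card_cube_gt0 : core.

(** * Covariance by averaging out one coordinate at a time *)

Section Interpolation.
Context {R : realType} {I : finType}.
Local Notation X := {ffun I -> bool}.
Implicit Types (f g F G H : X -> R) (x u : X) (i j : I).

(** The conditional expectation given all coordinates but [j]. *)
Definition avg j f x : R := (f x + f (flip j x)) / 2.

Definition avgs (s : seq I) f : X -> R := foldr avg f s.

Lemma avg_flips j u f : (forall x, f (flips u x) = f x) ->
  forall x, avg j f (flips u x) = avg j f x.
Proof. by move=> fu x; rewrite /avg /flip flipsC !fu. Qed.

Lemma avgs_flips s u f : (forall x, f (flips u x) = f x) ->
  forall x, avgs s f (flips u x) = avgs s f x.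
Proof. by move=> fu; elim: s => //= j s IH; exact: avg_flips. Qed.

Lemma umean_avg j f : umean (avg j f) = umean f.
Proof.
transitivity (umean (fun x => 2^-1 * (f x + f (flip j x)))).
  by apply: eq_umean => x; rewrite /avg mulrC.
by rewrite umeanZ umeanD umean_flips; field.
Qed.

Lemma umean_avgs s f : umean (avgs s f) = umean f.
Proof. by elim: s => //= j s IH; rewrite umean_avg. Qed.

Lemma dif_avgs j s f x : dif j (avgs s f) x = avgs s (dif j f) x.
Proof.
elim: s x => //= i s IH x; rewrite /avg -!IH /dif /flip flipsC.
by field.
Qed.

Lemma umean_avgs_sqr s f : umean (fun x => avgs s f x ^+ 2) <= umean (fun x => f x ^+ 2).
Proof.
elim: s => //= j s; apply: le_trans; set g := avgs s f.
rewrite -(umean_avg j (fun x => g x ^+ 2)); apply: ler_umean => x; rewrite /avg.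
rewrite -subr_ge0; set a := g x; set b := g _.
have -> : (a ^+ 2 + b ^+ 2) / 2 - ((a + b) / 2) ^+ 2 = ((a - b) / 2) ^+ 2 by field.
exact: sqr_ge0.
Qed.

Lemma avgs_flip s f j x : j \in s -> avgs s f (flip j x) = avgs s f x.
Proof.
elim: s x => //= i s IH x; rewrite inE => /orP[/eqP ->|js].
  by rewrite /avg /flip flipsK addrC.
by rewrite /avg /flip flipsC !IH.
Qed.

Lemma flip_invariant_cst f : (forall j x, f (flip j x) = f x) -> forall x y, f x = f y.
Proof.
move=> fI x y.
have [n] := ubnP #|[set i | x i != y i]|; elim: n x => // n IH x.
case: (set_0Vmem [set i | x i != y i]) => [e _|[j]].
  congr f; apply/ffunP => i; apply/eqP/negPn/negP => xy.
  by move/setP/(_ i): e; rewrite !inE xy.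
rewrite inE => xyj; rewrite (cardD1 j) inE xyj add1n ltnS => lt_n.
rewrite -(fI j); apply: IH; apply: leq_trans lt_n; rewrite ltnS.
apply: subset_leq_card; apply/fintype.subsetP => i.
rewrite !inE flipE; have [->|ne] := eqVneq i j; last by rewrite addbF.
by move: xyj; case: (x j) (y j) => [] [].
Qed.

Lemma avgs_enum f x : avgs (enum I) f x = umean f.
Proof.
rewrite -(umean_avgs (enum I) f) -[LHS](umean_cst (card_cube_gt0 (I := I))).
by apply: eq_umean => y; apply: flip_invariant_cst => j z; rewrite avgs_flip ?mem_enum.
Qed.

(** Averaging out the coordinates one after the other turns [G] into its mean,
    and the step at [j] only involves [dif j].  That step pairs [F] with a
    function which is invariant under [flips (u j)], because [G] is; hence [F]
    may first be averaged over [flips (u j)], and this can make its derivative at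
    [j] much smaller. *)
Lemma ler_norm_ucov_dif F G (u : I -> X) (A B : I -> R) :
  (forall j, 0 <= A j) -> (forall j, 0 <= B j) ->
  (forall j x, G (flips (u j) x) = G x) ->
  (forall j, umean (fun x =>
     dif j (fun y => (F y + F (flips (u j) y)) / 2) x ^+ 2) <= A j ^+ 2) ->
  (forall j, umean (fun x => dif j G x ^+ 2) <= B j ^+ 2) ->
  `|ucov F G| <= \sum_j 4^-1 * (A j * B j).
Proof.
move=> A0 B0 Gu FA GB.
have step j s : `|umean (fun x => F x * avgs s G x) -
    umean (fun x => F x * avg j (avgs s G) x)| <= 4^-1 * (A j * B j).
  set H := avgs s G.
  have -> : umean (fun x => F x * H x) - umean (fun x => F x * avg j H x) =
      2^-1 * umean (fun x => F x * dif j H x).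
    by rewrite -umeanB -umeanZ; apply: eq_umean => x; rewrite /avg /dif; field.
  have Hu x : dif j H (flips (u j) x) = dif j H x.
    by rewrite /dif /flip flipsC /H !(avgs_flips _ (Gu j)).
  have -> : umean (fun x => F x * dif j H x) =
      umean (fun x => (F x + F (flips (u j) x)) / 2 * dif j H x).
    set S := LHS.
    have e : umean (fun x => F (flips (u j) x) * dif j H x) = S.
      rewrite /S -(umean_flips (u j)); apply: eq_umean => x.
      by rewrite flipsK Hu.
    transitivity ((S + S) / 2); first by field.
    rewrite -{2}e -umeanD mulrC -umeanZ.
    by apply: eq_umean => x; field.
  rewrite umean_mul_dif; set e := umean _.
  have -> : 2^-1 * (2^-1 * e) = 4^-1 * e by field.
  rewrite normrM ger0_norm ?invr_ge0// ler_pM2l ?invr_gt0//.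
  apply: ler_norm_umeanM => //.
  under eq_umean do rewrite dif_avgs.
  exact: le_trans (umean_avgs_sqr _ _) (GB j).
(* The averages in [step] telescope along the list of coordinates. *)
have tele s : `|umean (fun x => F x * G x) - umean (fun x => F x * avgs s G x)|
    <= \sum_(j <- s) 4^-1 * (A j * B j).
  elim: s => [|j s IH]; first by rewrite subrr normr0 big_nil.
  rewrite big_cons [leRHS]addrC; apply: le_trans (lerD IH (step j s)).
  by apply: le_trans (ler_normD _ _); rewrite addrA subrK.
have := tele (enum I); rewrite big_enum/= ucovE//.
suff -> : umean (fun x => F x * avgs (enum I) G x) = umean F * umean G by [].
by rewrite mulrC -umeanZ; apply: eq_umean => x; rewrite avgs_enum mulrC.
Qed.

End Interpolation.

(** * Anticoncentration *)

Section Eigenfunctions.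
Context {R : realType} {I : finType}.
Local Notation X := {ffun I -> bool}.
Implicit Types (f g : X -> R) (x : X) (i j : I).

(** [Gam g] is twice the carre du champ of the operator [\sum_j dif j]. *)
Definition Gam g x : R := \sum_j dif j g x ^+ 2.

Lemma umean_mul_lap f g :
  umean (fun x => f x * \sum_j dif j g x) =
  2^-1 * umean (fun x => \sum_j dif j f x * dif j g x).
Proof.
transitivity (umean (fun x => \sum_j f x * dif j g x)).
  by apply: eq_umean => x; rewrite mulr_sumr.
by rewrite !umean_sum mulr_sumr; apply: eq_bigr => j _; rewrite umean_mul_dif.
Qed.

Lemma umean_eigen g (lam : R) : lam != 0 ->
  (forall x, \sum_j dif j g x = lam * g x) -> umean g = 0.
Proof.
move=> lam0 glam; apply: (mulfI lam0); rewrite mulr0 -umeanZ.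
transitivity (umean (fun x => \sum_j dif j g x)); first exact: eq_umean.
by rewrite umean_sum big1// => j _; rewrite umean_dif.
Qed.

(** Summation by parts against the eigenfunction itself; this computes all the
    variances below. *)
Lemma umean_sqr_eigen g (lam : R) :
  (forall x, \sum_j dif j g x = lam * g x) ->
  2 * lam * umean (fun x => g x ^+ 2) = umean (Gam g).
Proof.
move=> glam; rewrite -mulrA -umeanZ.
transitivity (2 * umean (fun x => g x * \sum_j dif j g x)).
  by congr (_ * _); apply: eq_umean => x; rewrite glam; ring.
by rewrite umean_mul_lap mulrA divff ?pnatr_eq0// mul1r.
Qed.

End Eigenfunctions.

Section Clamp.
Context {R : realType}.
Implicit Types s y d D : R.

Definition clamp s y : R := Num.max (- s) (Num.min s y).

Lemma clampP s y : 0 <= s ->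
  [\/ clamp s y = y /\ - s <= y <= s, clamp s y = s /\ s <= y
    | clamp s y = - s /\ y <= - s].
Proof.
move=> s0; rewrite /clamp; case: (leP s y) => sy.
  by constructor 2; rewrite max_r//; lra.
case: (leP (- s) y) => ys; last by constructor 3; split => //; lra.
by constructor 1; split => //; lra.
Qed.

Lemma clamp_norm s y : 0 <= s -> `|clamp s y| <= s.
Proof. by move=> s0; rewrite ler_norml; case: (clampP y s0) => -[-> ?]; lra. Qed.

Lemma clamp_id s y : `|y| <= s -> clamp s y = y.
Proof. by rewrite ler_norml /clamp => /andP[? ?]; rewrite min_r// max_r. Qed.

Lemma clamp_mul_ge0 s y : 0 <= s -> 0 <= y * clamp s y.
Proof. by move=> s0; case: (clampP y s0) => -[-> ?]; nra. Qed.

Lemma clamp_norm_le s y : 0 <= s -> `|clamp s y| <= `|y|.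
Proof.
move=> s0; have /ler_normlP[? ?] := lexx `|y|.
by rewrite ler_norml; case: (clampP y s0) => -[-> ?]; lra.
Qed.

Lemma clamp_homo s : 0 <= s -> {homo clamp s : x y / x <= y}.
Proof.
by move=> s0 x y xy; case: (clampP x s0) => -[-> ?]; case: (clampP y s0) => -[-> ?]; lra.
Qed.

(** Clamping is monotone, so it cannot reverse the sign of a jump. *)
Lemma clampB_mul_ge0 s y D d : 0 <= s -> 0 <= D * d -> `|d| <= `|D| ->
  0 <= (clamp s y - clamp s (y - D)) * d.
Proof.
move=> s0; case: (ltgtP d 0) => [d0|d0|->] Dd dD; last by rewrite mulr0.
- rewrite nmulr_lge0// subr_le0; apply: clamp_homo => //.
  have D0 : D <= 0 by nra.
  by lra.
- rewrite pmulr_lge0// subr_ge0; apply: clamp_homo => //.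
  have D0 : 0 <= D by nra.
  by lra.
Qed.

(** Clamping at level [3 * s] leaves room for steps of size [2 * s] that start
    within [s] of the centre. *)
Lemma clampB_mul_ge_sqr s y D d : 0 <= D * d -> `|d| <= `|D| -> `|d| <= 2 * s ->
  `|y| <= s -> d ^+ 2 <= (clamp (3 * s) y - clamp (3 * s) (y - D)) * d.
Proof.
move=> Dd dD ds ys; have s30 : 0 <= 3 * s by have := le_trans (normr_ge0 y) ys; lra.
rewrite (@clamp_id _ y); last first.
  by apply: le_trans ys _; have := le_trans (normr_ge0 _) ds; lra.
rewrite expr2; move: ys; rewrite ler_norml => /andP[? ?].
case: (ltgtP d 0) => [d0|d0|->]; last by rewrite !mulr0.
- have D0 : D <= 0 by nra.
  rewrite ler_nM2r//; move: dD ds; rewrite (ltr0_norm d0) (ler0_norm D0) => ? ?.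
  by case: (clampP (y - D) s30) => -[-> ?]; lra.
- have D0 : 0 <= D by nra.
  rewrite ler_pM2r//; move: dD ds; rewrite (gtr0_norm d0) (ger0_norm D0) => ? ?.
  by case: (clampP (y - D) s30) => -[-> ?]; lra.
Qed.

End Clamp.

Section Anticoncentration.
Context {R : realType} {I : finType}.
Local Notation X := {ffun I -> bool}.
Implicit Types (f g : X -> R) (x : X) (i j : I).

(** With [h := clamp (3 * s) (f - c)], the mean of [h * g] is at most
    [3 * s * W].  It is also [(2 * lam)^-1] times the mean of
    [\sum_j dif j h * dif j g]; all these products are nonnegative, and where
    [f] is within [s] of [c] the clamp does not reduce the jumps below those of
    [g], so that their sum is at least [Gam g]. *)
Lemma anticoncentration f g (c s lam kap W : R) :
  0 <= s -> 0 < lam -> 0 <= W ->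
  (forall x, \sum_j dif j g x = lam * g x) ->
  (forall j x, 0 <= dif j f x * dif j g x) ->
  (forall j x, `|dif j g x| <= `|dif j f x|) ->
  (forall j x, `|dif j g x| <= 2 * s) ->
  (forall x, `|f x - c| <= s -> kap <= Gam g x) ->
  umean (fun x => g x ^+ 2) <= W ^+ 2 ->
  kap * umean (fun x => (`|f x - c| <= s)%R%:R) <= 6 * s * lam * W.
Proof.
move=> s0 lam0 W0 glam fg_ge0 gf gs Gkap gW.
pose h x := clamp (3 * s) (f x - c).
have dh j x : dif j h x = clamp (3 * s) (f x - c) - clamp (3 * s) (f x - c - dif j f x).
  rewrite /dif /h; congr (_ - clamp _ _); ring.
have hg : umean (fun x => h x * g x) <= 3 * s * W.
  apply: le_trans (ler_norm _) _; apply: ler_norm_umeanM => //; first by lra.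
  rewrite -[leRHS](umean_cst (card_cube_gt0 (I := I))); apply: ler_umean => x.
  rewrite -[leLHS]real_normK ?num_real//.
  by rewrite ler_pXn2r ?nnegrE//; [apply: clamp_norm|]; lra.
have lower : 2^-1 * (kap * umean (fun x => (`|f x - c| <= s)%R%:R)) <=
    lam * umean (fun x => h x * g x).
  have -> : lam * umean (fun x => h x * g x) =
      umean (fun x => h x * \sum_j dif j g x).
    by rewrite -umeanZ; apply: eq_umean => x; rewrite glam; ring.
  rewrite umean_mul_lap ler_pM2l ?invr_gt0// -umeanZ; apply: ler_umean => x.
  case: (boolP (`|f x - c| <= s)) => [fc|_]; last first.
    by rewrite mulr0 sumr_ge0// => j _; rewrite dh clampB_mul_ge0//; lra.
  rewrite mulr1; apply: le_trans (Gkap x fc) _; apply: ler_sum => j _.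
  by rewrite dh clampB_mul_ge_sqr.
have : lam * umean (fun x => h x * g x) <= lam * (3 * s * W) by rewrite ler_pM2l.
by lra.
Qed.

End Anticoncentration.

(** * Linear forms *)

Section LinearForms.
Context {R : realType} {I : finType}.
Local Notation X := {ffun I -> bool}.
Implicit Types (a : I -> R) (x : X) (i j : I).

Definition linform a x : R := \sum_j spin R (x j) * a j.

Lemma spin_addb (b c : bool) : spin R (b (+) c) = spin R b * spin R c.
Proof. by rewrite /spin signr_addb. Qed.

Lemma spin_mul_id (b : bool) : spin R b * spin R b = 1.
Proof. by rewrite -spin_addb addbb /spin expr0. Qed.

Lemma spin_sqr (b : bool) : spin R b ^+ 2 = 1.
Proof. by rewrite expr2 spin_mul_id. Qed.

Lemma norm_spin (b : bool) : `|spin R b| = 1.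
Proof. by rewrite /spin normr_sign. Qed.

Lemma spin_flip j x i : spin R (flip j x i) = spin R (x i) * (if i == j then -1 else 1).
Proof. by rewrite flipE spin_addb; case: eqP => _; rewrite /spin ?expr1 ?expr0. Qed.

Lemma dif_linform j a x : dif j (linform a) x = 2 * (spin R (x j) * a j).
Proof.
rewrite /dif /linform -sumrB (bigD1 j)//= big1 ?addr0 => [|i ij].
  by rewrite spin_flip eqxx; ring.
by rewrite spin_flip (negbTE ij); ring.
Qed.

Lemma lap_linform a x : \sum_j dif j (linform a) x = 2 * linform a x.
Proof. by rewrite /linform mulr_sumr; apply: eq_bigr => j _; rewrite dif_linform. Qed.

Lemma Gam_linform a x : Gam (linform a) x = 4 * \sum_j a j ^+ 2.
Proof.
rewrite /Gam mulr_sumr; apply: eq_bigr => j _.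
by rewrite dif_linform !exprMn spin_sqr; ring.
Qed.

Lemma umean_linform_sqr a : umean (fun x => linform a x ^+ 2) = \sum_j a j ^+ 2.
Proof.
have := umean_sqr_eigen (lap_linform a).
have -> : umean (Gam (linform a)) = umean (fun _ : X => 4 * \sum_j a j ^+ 2).
  by apply: eq_umean => x; rewrite Gam_linform.
by rewrite (umean_cst (card_cube_gt0 (I := I))); lra.
Qed.

(** The Littlewood-Offord problem with arbitrary coefficients: test the linear
    form against the one whose coefficients are truncated at [s]. *)
Lemma linform_anticoncentration a (b s w : R) : 0 <= s -> 0 <= w ->
  w ^+ 2 <= \sum_j clamp s (a j) ^+ 2 ->
  w * umean (fun x => (`|linform a x - b| <= s)%R%:R) <= 3 * s.
Proof.
move=> s0 w0; set c := fun j => clamp s (a j); set P := umean _ => wc.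
have c0 : 0 <= \sum_j c j ^+ 2 by apply: sumr_ge0 => j _; exact: sqr_ge0.
have P0 : 0 <= P by apply: umean_ge0.
set W := Num.sqrt (\sum_j c j ^+ 2).
have WE : W ^+ 2 = \sum_j c j ^+ 2 by rewrite sqr_sqrtr.
have W0 : 0 <= W by exact: sqrtr_ge0.
have wW : w <= W by rewrite -(ler_pXn2r (n := 2)) ?nnegrE// WE.
have : 4 * W ^+ 2 * P <= 6 * s * 2 * W.
  apply: (@anticoncentration R I (linform a) (linform c)) => //.
  - exact: lap_linform.
  - move=> j x; rewrite !dif_linform.
    have -> : 2 * (spin R (x j) * a j) * (2 * (spin R (x j) * c j)) =
      4 * (spin R (x j) * spin R (x j)) * (a j * c j) by ring.
    by rewrite spin_mul_id mulr1 mulr_ge0// clamp_mul_ge0.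
  - move=> j x; rewrite !dif_linform !normrM norm_spin !mul1r ler_pM2l ?normr_gt0//.
    exact: clamp_norm_le.
  - move=> j x; rewrite !dif_linform !normrM norm_spin !mul1r normr_nat ler_pM2l//.
    exact: clamp_norm.
  - by move=> x _; rewrite Gam_linform WE.
  - by rewrite umean_linform_sqr WE.
move: W0; rewrite le_eqVlt => /orP[/eqP W0 _|W_gt0 h].
  have -> : w = 0 by lra.
  by rewrite mul0r mulr_ge0.
apply: (@le_trans _ _ (W * P)); first by rewrite ler_wpM2r.
by rewrite -(ler_pM2l W_gt0); nra.
Qed.

End LinearForms.

(** * Quadratic forms of the block sums *)

Section Blocks.
Context {R : realType} {I J : finType} (beta : I -> J).
Local Notation X := {ffun I -> bool}.
Implicit Types (a : I -> R) (x : X) (i j : I) (k l : J) (T : {set J}).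

Definition blockflip k : X := [ffun i => beta i == k].

Definition onblock k a j : R := if beta j == k then a j else 0.

Definition offblock k a j : R := if beta j == k then 0 else a j.

Lemma linform_block k a x : linform a x = linform (onblock k a) x + linform (offblock k a) x.
Proof.
rewrite /linform -big_split; apply: eq_bigr => j _ /=.
by rewrite /onblock /offblock; case: ifP => _; ring.
Qed.

Lemma linform_onblock k a x :
  linform (onblock k a) x = \sum_(j | beta j == k) spin R (x j) * a j.
Proof.
rewrite /linform [RHS]big_mkcond; apply: eq_bigr => j _.
by rewrite /onblock; case: ifP => // _; rewrite mulr0.
Qed.

Lemma onblock_flips k a x :
  linform (onblock k a) (flips (blockflip k) x) = - linform (onblock k a) x.
Proof.
rewrite /linform -sumrN; apply: eq_bigr => j _; rewrite !ffunE spin_addb /onblock.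
by case: ifP => _; rewrite ?mulr0 ?oppr0// /spin expr1; ring.
Qed.

Lemma offblock_flips k a x :
  linform (offblock k a) (flips (blockflip k) x) = linform (offblock k a) x.
Proof.
apply: eq_bigr => j _; rewrite !ffunE spin_addb /offblock.
by case: ifP => _; rewrite ?mulr0// /spin expr0; ring.
Qed.

Lemma umean_onblock_sqr k a :
  umean (fun x => linform (onblock k a) x ^+ 2) = \sum_(j | beta j == k) a j ^+ 2.
Proof.
rewrite umean_linform_sqr [RHS]big_mkcond; apply: eq_bigr => j _.
by rewrite /onblock; case: ifP => // _; rewrite expr0n.
Qed.

(** The sum of the signs in a block, as a linear form, so that the results on
    linear forms apply to it. *)
Definition bsum k : X -> R := linform (onblock k (fun=> 1)).

Lemma bsumE k x : bsum k x = \sum_(j | beta j == k) spin R (x j).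
Proof. by rewrite /bsum linform_onblock; apply: eq_bigr => j _; rewrite mulr1. Qed.

Lemma bsum_flip k j x :
  bsum k (flip j x) = bsum k x - (if beta j == k then 2 * spin R (x j) else 0).
Proof.
have := dif_linform j (onblock k (fun=> 1)) x; rewrite /dif -/(bsum _ _) -/(bsum _ _).
by rewrite /onblock; case: ifP => _; lra.
Qed.

Lemma bsum_flips k l x : bsum k (flips (blockflip l) x) ^+ 2 = bsum k x ^+ 2.
Proof.
have [<-|kl] := eqVneq k l; first by rewrite /bsum onblock_flips sqrrN.
congr (_ ^+ 2); rewrite !bsumE; apply: eq_bigr => j /eqP jk.
by rewrite !ffunE spin_addb jk (negbTE kl) /spin expr0 mulr1.
Qed.

Context (m : nat) (m_gt0 : (0 < m)%N).
Context (card_block : forall k, #|[pred j | beta j == k]| = m).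

Let mR_gt0 : 0 < m%:R :> R. Proof. by rewrite ltr0n. Qed.
Let mR_neq0 : m%:R != 0 :> R. Proof. exact: lt0r_neq0. Qed.

Lemma sum_block_cst k (c : R) : \sum_(j | beta j == k) c = m%:R * c.
Proof. by rewrite sumr_const card_block mulr_natl. Qed.

Lemma norm_bsum k x : `|bsum k x| <= m%:R.
Proof.
rewrite bsumE; apply: le_trans (ler_norm_sum _ _ _) _.
under eq_bigr do rewrite norm_spin.
by rewrite sum_block_cst mulr1.
Qed.

Lemma umean_bsum_sqr k : umean (fun x => bsum k x ^+ 2) = m%:R.
Proof.
rewrite umean_onblock_sqr; under eq_bigr do rewrite expr1n.
by rewrite sum_block_cst mulr1.
Qed.

(** The diagonal terms of a squared block sum add up to [m], so subtracting 1
    leaves a polynomial that is homogeneous of degree two, hence an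
    eigenfunction for the eigenvalue 4. *)
Definition qform T x : R := \sum_(k in T) (bsum k x ^+ 2 / m%:R - 1).

Lemma qform_flips T l x : qform T (flips (blockflip l) x) = qform T x.
Proof. by apply: eq_bigr => k _; rewrite bsum_flips. Qed.

Lemma dif_qform T j x : dif j (qform T) x =
  if beta j \in T then 4 / m%:R * (spin R (x j) * bsum (beta j) x - 1) else 0.
Proof.
rewrite /dif /qform -sumrB; case: ifP => [jT|/negbT jT].
  rewrite (bigD1 (beta j))//= big1 ?addr0 => [|k /andP[_ kj]].
    rewrite bsum_flip eqxx; have := spin_mul_id (R := R) (x j).
    set e := spin _ _; set w := bsum _ _ => ee.
    transitivity (4 / m%:R * (e * w - e * e)); first by field.
    by rewrite ee.
  by rewrite bsum_flip eq_sym (negbTE kj) subr0; ring.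
rewrite big1// => k kT; rewrite bsum_flip; have [jk|_] := eqVneq (beta j) k.
  by rewrite jk kT in jT.
by rewrite subr0; ring.
Qed.

Lemma sum_over_blocks (F : I -> R) T (P : pred I) : (forall j, P j = (beta j \in T)) ->
  \sum_(j | P j) F j = \sum_(k in T) \sum_(j | beta j == k) F j.
Proof.
move=> PT; rewrite (partition_big beta (mem T))/= => [|j]; last by rewrite PT.
apply: eq_bigr => k kT; apply: eq_bigl => j.
by rewrite PT; case: eqP => [->|_]; rewrite ?kT ?andbF.
Qed.

Lemma lap_qform T x : \sum_j dif j (qform T) x = 4 * qform T x.
Proof.
under eq_bigr do rewrite dif_qform.
rewrite -big_mkcond (sum_over_blocks _ (T := T))// /qform mulr_sumr.
apply: eq_bigr => k kT; rewrite -mulr_sumr.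
under eq_bigr => j /eqP jk do rewrite jk.
by rewrite sumrB -mulr_suml -bsumE sum_block_cst; field.
Qed.

Lemma Gam_qform T x : Gam (qform T) x =
  16 * ((1 - 2 / m%:R) * qform T x + (1 - m%:R^-1) * #|T|%:R).
Proof.
rewrite /Gam; transitivity (\sum_(j | beta j \in T)
    (16 / m%:R ^+ 2) * (bsum (beta j) x ^+ 2 + 1 - 2 * bsum (beta j) x * spin R (x j))).
  rewrite [RHS]big_mkcond; apply: eq_bigr => j _; rewrite dif_qform.
  case: ifP => _; last by rewrite expr0n.
  have := spin_mul_id (R := R) (x j); set e := spin _ _; set w := bsum _ _ => ee.
  transitivity ((16 / m%:R ^+ 2) * (w ^+ 2 * (e * e) + 1 - 2 * w * e)); first by field.
  by rewrite ee mulr1.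
rewrite (sum_over_blocks _ (T := T))//.
transitivity (\sum_(k in T) 16 * ((1 - 2 / m%:R) * (bsum k x ^+ 2 / m%:R - 1) + (1 - m%:R^-1))).
  apply: eq_bigr => k kT; rewrite -mulr_sumr.
  under eq_bigr => j /eqP jk do rewrite jk.
  by rewrite sumrB -mulr_sumr -bsumE sum_block_cst; field.
by rewrite -mulr_sumr big_split -mulr_sumr sumr_const mulr_natr.
Qed.

Lemma umean_qform T : umean (qform T) = 0.
Proof. by apply: (@umean_eigen _ _ _ 4); [rewrite pnatr_eq0|exact: lap_qform]. Qed.

Lemma umean_qform_sqr T : umean (fun x => qform T x ^+ 2) <= 2 * #|T|%:R.
Proof.
have := umean_sqr_eigen (lap_qform T).
have -> : umean (Gam (qform T)) = 16 * ((1 - m%:R^-1) * #|T|%:R).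
  rewrite (eq_umean (Gam_qform T)) umeanZ umeanD umeanZ umean_qform mulr0 add0r.
  by rewrite (umean_cst (card_cube_gt0 (I := I))).
have mV : 0 <= m%:R^-1 :> R by rewrite invr_ge0 ler0n.
have T0 : 0 <= #|T|%:R :> R by exact: ler0n.
by nra.
Qed.

Lemma norm_dif_qform T j x : `|dif j (qform T) x| <= 8.
Proof.
rewrite dif_qform; case: ifP => _; last by rewrite normr0.
have m1 : 1 <= m%:R :> R by rewrite ler1n.
rewrite normrM ger0_norm ?divr_ge0// mulrAC ler_pdivrMr//.
suff : `|spin R (x j) * bsum (beta j) x - 1| <= m%:R + 1 by lra.
apply: le_trans (ler_normB _ _) _.
by rewrite normrM norm_spin normr1 mul1r lerD2r norm_bsum.
Qed.

(** Bounding the quadratic mean rather than the maximum gains a factor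
    [sqrt m]: a block sum is typically of size [sqrt m], not [m]. *)
Lemma umean_dif_qform_sqr T j :
  umean (fun x => dif j (qform T) x ^+ 2) <=
    if beta j \in T then (8 / Num.sqrt m%:R) ^+ 2 else 0.
Proof.
case: ifPn => jT; last first.
  rewrite -[leRHS](umean_cst (card_cube_gt0 (I := I))); apply: ler_umean => x.
  by rewrite dif_qform (negbTE jT) expr0n.
have m1 : 1 <= m%:R :> R by rewrite ler1n.
rewrite exprMn exprVn sqr_sqrtr ?ler0n//.
apply: (@le_trans _ _ (16 / m%:R ^+ 2 * umean (fun x => 2 * bsum (beta j) x ^+ 2 + 2))).
  rewrite -umeanZ; apply: ler_umean => x; rewrite dif_qform jT exprMn.
  have -> : (4 / m%:R) ^+ 2 = 16 / m%:R ^+ 2 :> R by field.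
  rewrite ler_pM2l ?divr_gt0// ?exprn_gt0//.
  have := spin_mul_id (R := R) (x j); set e := spin _ _; set w := bsum _ _ => ee.
  have : 0 <= (e * w + 1) ^+ 2 by exact: sqr_ge0.
  have : (e * w) ^+ 2 = w ^+ 2 by rewrite exprMn expr2 ee mul1r.
  by nra.
rewrite umeanD umeanZ umean_bsum_sqr (umean_cst (card_cube_gt0 (I := I))).
rewrite -subr_ge0.
have -> : 8 ^+ 2 / m%:R - 16 / m%:R ^+ 2 * (2 * m%:R + 2) = 32 / m%:R ^+ 2 * (m%:R - 1) :> R.
  by field.
by rewrite mulr_ge0 ?divr_ge0 ?exprn_ge0 ?ler0n// subr_ge0.
Qed.

(** The quadratic form is tested against itself: where it is close to its mean,
    its own carre du champ is of the order of the number of blocks. *)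
Lemma qform_anticoncentration T (s : R) : (1 < m)%N -> 4 <= s -> s <= #|T|%:R / 2 ->
  Num.sqrt #|T|%:R * umean (fun x => (`|qform T x| <= s)%R%:R) <= 5 * s.
Proof.
move=> m_gt1 s4 sT; have T0 : 0 < #|T|%:R :> R by lra.
set P := umean _.
have : 8 * #|T|%:R * P <= 6 * s * 4 * Num.sqrt (2 * #|T|%:R).
  rewrite /P; under eq_umean do rewrite -[qform T _]subr0.
  apply: (@anticoncentration R I (qform T) (qform T)) => //; [by lra|..].
  - exact: lap_qform.
  - by move=> j x; rewrite -expr2 sqr_ge0.
  - by move=> j x; apply: le_trans (norm_dif_qform _ _ _) _; lra.
  - move=> x; rewrite subr0 Gam_qform ler_norml => /andP[q1 q2].
    have m2 : 2 / m%:R <= 1 :> R by rewrite ler_pdivrMr// mul1r ler_nat.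
    by nra.
  - by rewrite sqr_sqrtr ?umean_qform_sqr// mulr_ge0.
rewrite sqrtrM// => h.
set q := Num.sqrt #|T|%:R in h *.
have q0 : 0 < q by rewrite sqrtr_gt0.
have qq : q ^+ 2 = #|T|%:R by rewrite sqr_sqrtr// ltW.
have r2 : Num.sqrt 2 <= 5 / 3 :> R.
  by rewrite -(ler_pXn2r (n := 2)) ?nnegrE ?sqrtr_ge0 ?divr_ge0// sqr_sqrtr//; lra.
rewrite -(ler_pM2l q0); rewrite -qq in h.
have : s * q * Num.sqrt 2 <= s * q * (5 / 3) by rewrite ler_wpM2l// mulr_ge0; lra.
by lra.
Qed.

End Blocks.

(** * A smoothed threshold *)

Section Smoothing.
Context {R : realType}.
Implicit Types (b s t u v x y M : R).

Definition possqr y : R := Num.max 0 y ^+ 2.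

Lemma possqrP y : (possqr y = 0 /\ y <= 0) \/ (possqr y = y ^+ 2 /\ 0 <= y).
Proof.
rewrite /possqr; case: (leP 0 y) => y0; [right|left] => //.
by rewrite expr0n ltW.
Qed.

Lemma possqr_even_homo M x y : 0 <= y -> y <= x ->
  0 <= possqr (M + x) + possqr (M - x) - (possqr (M + y) + possqr (M - y))
    <= 2 * (x ^+ 2 - y ^+ 2).
Proof.
move=> y0 yx.
by case: (possqrP (M + x)) => -[-> h1]; case: (possqrP (M - x)) => -[-> h2];
  case: (possqrP (M + y)) => -[-> h3]; case: (possqrP (M - y)) => -[-> h4];
  apply/andP; split; nra.
Qed.

(** As a function of [x], the even part of [possqr] around [M] has derivative
    zero at the origin and second derivative at most 4, hence it is Lipschitz as
    a function of the square of [x]. *)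
Lemma possqr_even_lip M x y :
  `|possqr (M + x) + possqr (M - x) - (possqr (M + y) + possqr (M - y))|
    <= 2 * `|x ^+ 2 - y ^+ 2|.
Proof.
have even z : possqr (M + z) + possqr (M - z) = possqr (M + `|z|) + possqr (M - `|z|).
  by case: (ger0P z) => z0 //; rewrite opprK addrC.
rewrite (even x) (even y) -[x ^+ 2]real_normK ?num_real// -[y ^+ 2]real_normK ?num_real//.
have [x0 y0] : 0 <= `|x| /\ 0 <= `|y| by [].
move: (`|x|) (`|y|) x0 y0 => {even}{}x {}y x0 y0.
wlog yx : x y x0 y0 / y <= x.
  move=> wl; case: (leP y x) => [|/ltW] xy; first exact: wl.
  by rewrite distrC [leRHS](_ : _ = 2 * `|y ^+ 2 - x ^+ 2|) ?wl// distrC.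
have /andP[e0 e1] := possqr_even_homo M y0 yx.
rewrite ger0_norm//; apply: le_trans e1 _.
by rewrite ler_pM2l// ler_norm.
Qed.

(** The indicator of [u <= b] averaged over shifts of [b] by a triangular
    density on [-s, s]; half the second difference of [possqr] is its integral. *)
Definition threshold b s u : R :=
  let v := (u - b) / s in
  1 - (possqr (v + 1) - 2 * possqr v + possqr (v - 1)) / 2.

Lemma threshold_itv b s u : 0 <= threshold b s u <= 1.
Proof.
rewrite /threshold; set v := (u - b) / s.
by case: (possqrP (v + 1)) => -[-> h1]; case: (possqrP v) => -[-> h2];
  case: (possqrP (v - 1)) => -[-> h3]; apply/andP; split; nra.
Qed.

Lemma ind_threshold b s u : 0 < s ->
  `|(u <= b)%R%:R - threshold b s u| <= (`|u - b| <= s)%R%:R.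
Proof.
move=> s0; have [us|] := leP `|u - b| s.
  have := threshold_itv b s u; case: (u <= b) => /= /andP[h1 h2];
    rewrite ler_norml; apply/andP; split; rewrite ?mulr1n ?mulr0n; lra.
move=> us; have vE : (u - b) / s * s = u - b by rewrite divfK// gt_eqF.
set v := (u - b) / s in vE.
suff -> : threshold b s u = (u <= b)%R%:R by rewrite subrr normr0.
rewrite /threshold -/v; case: (leP u b) => ub; rewrite ?mulr1n ?mulr0n.
  have v1 : v < -1 by move: us; rewrite ler0_norm ?subr_le0// => us; nra.
  case: (possqrP (v + 1)) => -[-> h1]; case: (possqrP v) => -[-> h2];
    case: (possqrP (v - 1)) => -[-> h3]; nra.
have v1 : 1 < v by move: us; rewrite gtr0_norm ?subr_gt0// => us; nra.
case: (possqrP (v + 1)) => -[-> h1]; case: (possqrP v) => -[-> h2];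
  case: (possqrP (v - 1)) => -[-> h3]; nra.
Qed.

Lemma threshold_even_lip b s M x y : 0 < s ->
  `|threshold b s (M + x) + threshold b s (M - x)
    - (threshold b s (M + y) + threshold b s (M - y))|
    <= 4 / s ^+ 2 * `|x ^+ 2 - y ^+ 2|.
Proof.
move=> s0; have s_neq0 : s != 0 by rewrite gt_eqF.
set V := (M - b) / s.
have vD z : (M + z - b) / s = V + z / s by rewrite /V; field.
have vB z : (M - z - b) / s = V - z / s by rewrite /V; field.
rewrite /threshold !vB !vD.
have lip N := possqr_even_lip N (x / s) (y / s).
have := lip (V + 1); have := lip V; have := lip (V - 1).
have -> : (x / s) ^+ 2 - (y / s) ^+ 2 = (x ^+ 2 - y ^+ 2) / s ^+ 2 by field.
rewrite normrM normfV (ger0_norm (sqr_ge0 s)).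
rewrite !(addrAC V 1) !(addrAC V (-1)).
rewrite -mulrA (mulrC (s ^+ 2)^-1).
set d := _ / s ^+ 2.
move=> /ler_normlP[? ?] /ler_normlP[? ?] /ler_normlP[? ?].
by rewrite ler_norml; apply/andP; split; lra.
Qed.

End Smoothing.

(** * Half-spaces against the ball *)

Section Cutoff.
Context {R : realType}.
Implicit Types t y z : R.

(** One derivative is enough here, so a piecewise linear approximation of the
    indicator of [y <= 0] does. *)
Definition cutoff t y : R := (1 - clamp t y / t) / 2.

Lemma cutoff_itv t y : 0 < t -> 0 <= cutoff t y <= 1.
Proof.
move=> t0; have : `|clamp t y / t| <= 1.
  by rewrite normrM normfV (gtr0_norm t0) ler_pdivrMr// mul1r clamp_norm// ltW.
by rewrite ler_norml /cutoff => /andP[? ?]; apply/andP; split; lra.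
Qed.

Lemma ind_cutoff t y : 0 < t -> `|(y <= 0)%R%:R - cutoff t y| <= (`|y| <= t)%R%:R.
Proof.
move=> t0; have [yt|] := leP `|y| t.
  have := cutoff_itv y t0; case: (y <= 0) => /= /andP[h1 h2];
    rewrite ler_norml; apply/andP; split; rewrite ?mulr1n ?mulr0n; lra.
move=> yt; suff -> : cutoff t y = (y <= 0)%R%:R by rewrite subrr normr0.
have t_neq0 : t != 0 by rewrite gt_eqF.
rewrite /cutoff; case: (leP y 0) => y0; rewrite ?mulr1n ?mulr0n; move: yt.
  rewrite ler0_norm// => yt; case: (clampP y (ltW t0)) => -[-> ?]; try lra.
  by field.
rewrite gtr0_norm// => yt; case: (clampP y (ltW t0)) => -[-> ?]; try lra.
by field.
Qed.

Lemma cutoff_lip t y z : 0 < t -> `|cutoff t y - cutoff t z| <= `|y - z| / (2 * t).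
Proof.
move=> t0; have t_neq0 : t != 0 by rewrite gt_eqF.
have -> : cutoff t y - cutoff t z = (clamp t z - clamp t y) / (2 * t).
  by rewrite /cutoff; field.
rewrite normrM normfV (@ger0_norm _ (2 * t)) ?mulr_ge0 ?(ltW t0)//.
rewrite ler_wpM2r ?invr_ge0 ?mulr_ge0 ?(ltW t0)//.
have /ler_normlP[? ?] := lexx `|y - z|.
by rewrite ler_norml; case: (clampP y (ltW t0)) => -[-> ?];
  case: (clampP z (ltW t0)) => -[-> ?]; apply/andP; split; lra.
Qed.

End Cutoff.

Section Covariance.
Context {R : realType} {I J : finType} (beta : I -> J).
Local Notation X := {ffun I -> bool}.
Implicit Types (a : I -> R) (b s t : R) (x : X) (i j : I) (k l : J) (T : {set J}).
Local Notation blockflip := (blockflip beta).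

Definition blocknorm2 a k : R := \sum_(j | beta j == k) a j ^+ 2.

Lemma blocknorm2_ge0 a k : 0 <= blocknorm2 a k.
Proof. by apply: sumr_ge0 => j _; exact: sqr_ge0. Qed.

Lemma ler_blocknorm2 a j : a j ^+ 2 <= blocknorm2 a (beta j).
Proof.
rewrite /blocknorm2 (bigD1 j)//= lerDl; apply: sumr_ge0 => i _; exact: sqr_ge0.
Qed.

(** Averaging over the sign of the block of [j] cancels the first-order term of
    the derivative at [j], which is of order [|a j| / s]; what remains is smaller
    by a factor of the order of the block part of the form over [s]. *)
Lemma norm_dif_threshold a b s j x : 0 < s ->
  `|dif j (fun y => (threshold b s (linform a y) +
      threshold b s (linform a (flips (blockflip (beta j)) y))) / 2) x| <=
    8 / s ^+ 2 * `|a j| * `|linform (onblock beta (beta j) a) x - spin R (x j) * a j|.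
Proof.
move=> s0; rewrite /dif !(linform_block beta (beta j) a).
rewrite !onblock_flips !offblock_flips.
have offE : linform (offblock beta (beta j) a) (flip j x) = linform (offblock beta (beta j) a) x.
  have := dif_linform j (offblock beta (beta j) a) x; rewrite /dif {3}/offblock eqxx.
  by lra.
have onE : linform (onblock beta (beta j) a) (flip j x) =
    linform (onblock beta (beta j) a) x - 2 * (spin R (x j) * a j).
  have := dif_linform j (onblock beta (beta j) a) x; rewrite /dif {3}/onblock eqxx.
  by lra.
rewrite offE onE; set M := linform (offblock _ _ _) _; set L := linform (onblock _ _ _) _.
set e := spin R (x j); set c := a j.
rewrite -mulrBl normrM normfV normr_nat !(addrC _ M).
apply: le_trans (ler_wpM2r _ (threshold_even_lip b M L (L - 2 * (e * c)) s0)) _.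
  by rewrite invr_ge0.
have -> : L ^+ 2 - (L - 2 * (e * c)) ^+ 2 = 4 * e * c * (L - e * c) by ring.
rewrite !normrM norm_spin normr_nat mulr1 le_eqVlt; apply/orP; left; apply/eqP.
by field; rewrite gt_eqF.
Qed.

Context (m : nat) (m_gt0 : (0 < m)%N).
Context (card_block : forall k, #|[pred j | beta j == k]| = m).

Lemma umean_dif_threshold_sqr a b s j : 0 < s ->
  umean (fun x => dif j (fun y => (threshold b s (linform a y) +
      threshold b s (linform a (flips (blockflip (beta j)) y))) / 2) x ^+ 2) <=
    (16 / s ^+ 2 * `|a j| * Num.sqrt (blocknorm2 a (beta j))) ^+ 2.
Proof.
move=> s0; set N := blocknorm2 a (beta j).
apply: (@le_trans _ _ ((8 / s ^+ 2 * `|a j|) ^+ 2 *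
    umean (fun x => 2 * linform (onblock beta (beta j) a) x ^+ 2 + 2 * a j ^+ 2))).
  rewrite -umeanZ; apply: ler_umean => x.
  rewrite -[leLHS]real_normK ?num_real//.
  apply: (@le_trans _ _ ((8 / s ^+ 2 * `|a j| *
      `|linform (onblock beta (beta j) a) x - spin R (x j) * a j|) ^+ 2)).
    rewrite ler_pXn2r ?nnegrE ?norm_dif_threshold// !mulr_ge0//.
    by rewrite invr_ge0 sqr_ge0.
  rewrite exprMn ler_wpM2l ?sqr_ge0// real_normK ?num_real//.
  have := spin_mul_id (R := R) (x j); set e := spin _ _; set w := linform _ _ => ee.
  have : 0 <= (w + e * a j) ^+ 2 by exact: sqr_ge0.
  have : (e * a j) ^+ 2 = a j ^+ 2 by rewrite exprMn expr2 ee mul1r.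
  by nra.
rewrite umeanD umeanZ umean_onblock_sqr -/(blocknorm2 _ _) -/N.
rewrite (umean_cst (card_cube_gt0 (I := I))).
rewrite [leRHS]exprMn sqr_sqrtr ?blocknorm2_ge0//.
have -> : (16 / s ^+ 2 * `|a j|) ^+ 2 = (8 / s ^+ 2 * `|a j|) ^+ 2 * 4.
  by field; rewrite gt_eqF.
rewrite -[leRHS]mulrA ler_wpM2l ?sqr_ge0//.
by have := ler_blocknorm2 a j; rewrite -/N; lra.
Qed.

(** In [ler_norm_ucov_dif], the derivative of the threshold at [j] is of order
    [|a j| * |a_k| / s ^ 2], where [a_k] is the restriction of [a] to the block
    of [j], and that of the cutoff is of order [(t * sqrt m)^-1] or zero.  By
    [2 * u * v <= u ^ 2 + v ^ 2], the sum of [|a j| * |a_k| / sqrt m] over the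
    block is at most [|a_k| ^ 2]. *)
Lemma ucov_threshold_cutoff a b s t T : 0 < s -> 0 < t ->
  `|ucov (fun x => threshold b s (linform a x)) (fun x => cutoff t (qform beta m T x))|
    <= 16 * (\sum_(k in T) blocknorm2 a k) / (s ^+ 2 * t).
Proof.
move=> s0 t0.
have mR_gt0 : 0 < m%:R :> R by rewrite ltr0n.
have q0 : 0 < Num.sqrt m%:R :> R by rewrite sqrtr_gt0.
pose A j := 16 / s ^+ 2 * `|a j| * Num.sqrt (blocknorm2 a (beta j)).
pose B j := if beta j \in T then 4 / (t * Num.sqrt m%:R) else 0 : R.
have A0 j : 0 <= A j by rewrite !mulr_ge0 ?sqrtr_ge0 ?invr_ge0 ?sqr_ge0.
have B0 j : 0 <= B j.
  by rewrite /B; case: ifP => // _; rewrite divr_ge0// mulr_ge0 ?ltW.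
apply: le_trans (ler_norm_ucov_dif (u := fun j => blockflip (beta j)) A0 B0 _ _ _) _.
- by move=> j x; rewrite qform_flips.
- by move=> j; exact: umean_dif_threshold_sqr.
- move=> j; apply: (@le_trans _ _ ((2 * t) ^- 2 * umean (fun x => dif j (qform beta m T) x ^+ 2))).
    rewrite -umeanZ; apply: ler_umean => x.
    rewrite -exprVn -exprMn -[leLHS]real_normK ?num_real// -[leRHS]real_normK ?num_real//.
    rewrite ler_pXn2r ?nnegrE//; apply: le_trans (cutoff_lip _ _ t0) _.
    by rewrite normrM normfV (@ger0_norm _ (2 * t)) ?mulr_ge0 ?(ltW t0)// mulrC.
  apply: le_trans (ler_wpM2l _ (umean_dif_qform_sqr m_gt0 card_block T j)) _.
    by rewrite invr_ge0 sqr_ge0.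
  rewrite /B; case: ifP => _; last by rewrite mulr0 sqr_ge0.
  by rewrite le_eqVlt; apply/orP; left; apply/eqP; field; rewrite !gt_eqF.
apply: (@le_trans _ _ (\sum_(j | beta j \in T)
    8 / (s ^+ 2 * t) * (a j ^+ 2 + blocknorm2 a (beta j) / m%:R))).
  rewrite [leRHS]big_mkcond; apply: ler_sum => j _; rewrite /A /B.
  case: ifP => _; last by rewrite !mulr0.
  set N := blocknorm2 _ _; set q := Num.sqrt m%:R in q0 *.
  have <- : q ^+ 2 = m%:R by rewrite sqr_sqrtr// ltW.
  have -> : 4^-1 * (16 / s ^+ 2 * `|a j| * Num.sqrt N * (4 / (t * q))) =
      8 / (s ^+ 2 * t) * (2 * `|a j| * (Num.sqrt N / q)).
    by field; rewrite !gt_eqF.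
  rewrite ler_pM2l ?divr_gt0 ?mulr_gt0 ?exprn_gt0//.
  have -> : N / q ^+ 2 = (Num.sqrt N / q) ^+ 2.
    by rewrite expr_div_n (@sqr_sqrtr _ N)//; exact: blocknorm2_ge0.
  rewrite -[a j ^+ 2]real_normK ?num_real// -subr_ge0.
  set u := `|a j|; set v := _ / q.
  have -> : u ^+ 2 + v ^+ 2 - 2 * u * v = (u - v) ^+ 2 by ring.
  exact: sqr_ge0.
rewrite (sum_over_blocks (beta := beta) _ (T := T))// le_eqVlt; apply/orP; left; apply/eqP.
have -> : 16 * (\sum_(k in T) blocknorm2 a k) / (s ^+ 2 * t) =
  16 / (s ^+ 2 * t) * \sum_(k in T) blocknorm2 a k by rewrite mulrAC.
rewrite mulr_sumr.
apply: eq_bigr => k kT; rewrite -mulr_sumr big_split /=.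
under [X in _ + X]eq_bigr => j /eqP jk do rewrite jk.
rewrite (sum_block_cst card_block) -/(blocknorm2 _ _).
by field; rewrite !gt_eqF.
Qed.

(** If the coefficients vanish on the blocks of [T], the two functions depend on
    disjoint sets of coordinates: for each [j], one of the two derivatives in
    [ler_norm_ucov_dif] is zero.  This covers the case where the width of
    the threshold would be zero. *)
Lemma ucov_halfspace_cutoff0 a b t T : 0 < t ->
  (forall k, k \in T -> blocknorm2 a k = 0) ->
  `|ucov (fun x => (linform a x <= b)%R%:R) (fun x => cutoff t (qform beta m T x))| <= 0.
Proof.
move=> t0 aT; set G := fun x => cutoff _ _; set F := fun x => _.
pose A j := (a j != 0)%:R : R; pose B j := (a j == 0)%:R : R.
have diff01 (f : X -> R) j x : (forall y, 0 <= f y <= 1) -> dif j f x ^+ 2 <= 1.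
  move=> f01; rewrite /dif; move: (f01 x) (f01 (flip j x)) => /andP[? ?] /andP[? ?].
  by nra.
have F01 y : 0 <= F y <= 1 by exact: natb_itv.
apply: le_trans (ler_norm_ucov_dif (u := fun=> [ffun=> false]) (A := A) (B := B) _ _ _ _ _) _.
- by move=> j; exact: ler0n.
- by move=> j; exact: ler0n.
- by move=> j x; congr G; apply/ffunP => i; rewrite !ffunE; case: (x i).
- move=> j; rewrite -[leRHS](umean_cst (card_cube_gt0 (I := I))); apply: ler_umean => x.
  have flips0 y : flips [ffun=> false] y = y :> X.
    by apply/ffunP => i; rewrite !ffunE; case: (y i).
  rewrite /A; have [aj0|_] := eqVneq (a j) 0; last first.
    rewrite expr1n; apply: diff01 => y; rewrite flips0.
    by have /andP[? ?] := F01 y; apply/andP; split; lra.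
  have := dif_linform j a x; rewrite aj0 !mulr0 => /eqP; rewrite subr_eq0 => /eqP e.
  by rewrite /dif /= !flips0 /F e subrr !expr0n.
- move=> j; rewrite -[leRHS](umean_cst (card_cube_gt0 (I := I))); apply: ler_umean => x.
  rewrite /B; have [aj0|aj0] := eqVneq (a j) 0.
    by rewrite expr1n; apply: diff01 => y; exact: cutoff_itv.
  have jT : beta j \notin T.
    apply/negP => /aT N0; move/negP: aj0; apply; rewrite -sqrf_eq0 eq_le sqr_ge0 andbT.
    by rewrite -N0 ler_blocknorm2.
  have := dif_qform (R := R) beta m_gt0 T j x; rewrite (negbTE jT) => /eqP.
  by rewrite subr_eq0 => /eqP e; rewrite /dif /G e subrr !expr0n.
by rewrite big1// => j _; rewrite /A /B; case: eqP => _; rewrite ?mulr0 ?mul0r ?mulr0.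
Qed.

End Covariance.

Lemma exists_top_set {R : realType} {J : finType} (N : J -> R) (K : nat) :
  (0 < K <= #|J|)%N ->
  exists (T : {set J}) (k0 : J), [/\ #|T| = K, k0 \in T,
    forall k, k \in T -> N k0 <= N k & forall k, k \notin T -> N k <= N k0].
Proof.
case: K => // K; elim: K => [|K IH] /= KJ.
  have /card_gt0P[j0 _] := KJ.
  case: (arg_maxP N (i0 := j0) (P := predT)) => // k0 _ k0max.
  exists [set k0], k0; rewrite cards1 set11; split => // k; last by move=> _; exact: k0max.
  by rewrite inE => /eqP ->.
have [T [k0 [cT k0T Tk0 k0T']]] := IH (ltnW KJ).
have [j0 j0T] : exists j0, j0 \notin T.
  have /card_gt0P[j0] : (0 < #|~: T|)%N by rewrite cardsCs finset.setCK subn_gt0 cT.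
  by rewrite inE; exists j0.
case: (arg_maxP N (P := [pred j | j \notin T]) j0T) => k1 /= k1T k1max.
exists (k1 |: T), k1; rewrite cardsU1 k1T cT setU11; split => // k.
- rewrite !inE => /orP[/eqP ->//|/Tk0]; apply: le_trans; exact: k0T'.
- by rewrite !inE negb_or => /andP[_ kT]; exact: k1max.
Qed.

Section Bound.
Context {R : realType} {I J : finType} (beta : I -> J) (m : nat).
Local Notation X := {ffun I -> bool}.
Implicit Types (a : I -> R) (b r s t : R) (x : X) (i j : I) (k l : J) (T : {set J}).
Context (m_gt0 : (0 < m)%N).
Context (card_block : forall k, #|[pred j | beta j == k]| = m).

Let iB x : R := (qform beta m [set: J] x <= 0 :> R)%R%:R.

(** The first term bounds the probability that the form is within [t] of the
    boundary; in the second, [w] bounds the quadratic mean of the part that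
    belongs to [T], and [(2 * t)^-1] is the Lipschitz constant of the cutoff. *)
Lemma ball_cutoff t (T : {set J}) (w : R) :
  (1 < m)%N -> 4 <= t -> t <= #|J|%:R / 2 -> 0 <= w -> 2 * #|T|%:R <= w ^+ 2 ->
  umean (fun x => `|iB x - cutoff t (qform beta m (~: T) x)|)
    <= 5 * t / Num.sqrt #|J|%:R + w / (2 * t).
Proof.
move=> m_gt1 t4 tJ w0 Tw; have t0 : 0 < t by lra.
apply: (@le_trans _ _ (umean (fun x => (`|qform beta m [set: J] x| <= t)%R%:R +
    (2 * t)^-1 * `|qform beta m T x|))).
  apply: ler_umean => x.
  have -> : iB x - cutoff t (qform beta m (~: T) x) =
    (iB x - cutoff t (qform beta m [set: J] x)) +
    (cutoff t (qform beta m [set: J] x) - cutoff t (qform beta m (~: T) x)) by ring.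
  apply: le_trans (ler_normD _ _) _; apply: lerD; first exact: ind_cutoff.
  apply: le_trans (cutoff_lip _ _ t0) _; rewrite mulrC.
  rewrite {1}/qform (bigID (mem T))/=.
  rewrite (eq_bigl (mem T)) => [|k]; last by rewrite inE.
  rewrite [X in _ + X - _](eq_bigl (mem (~: T))) => [|k]; last by rewrite !inE.
  by rewrite addrK.
rewrite umeanD umeanZ; apply: lerD.
  rewrite ler_pdivlMr ?sqrtr_gt0; last by lra.
  rewrite mulrC -cardsT; apply: qform_anticoncentration => //.
  by rewrite cardsT.
rewrite mulrC ler_pM2r ?invr_gt0 ?mulr_gt0//.
apply: ler_norm_umean1 => //; apply: le_trans Tw; exact: umean_qform_sqr.
Qed.

(** The width [s] is at least the norm of every block outside [T].  If it is
    equal to [sigma / r], the coefficients outside [T] are thus not truncated at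
    [s], and their squares add up to [(r * s) ^ 2].  Otherwise each of the at
    least [r ^ 2] blocks of [T] has norm at least [s], and still has it after
    truncation. *)
Lemma halfspace_threshold a b r s (T : {set J}) (k0 : J) : 0 < r -> 0 < s ->
  r ^+ 2 <= #|T|%:R ->
  (forall k, k \in T -> blocknorm2 beta a k0 <= blocknorm2 beta a k) ->
  (forall k, k \notin T -> blocknorm2 beta a k <= blocknorm2 beta a k0) ->
  s ^+ 2 = Num.max ((\sum_(k in ~: T) blocknorm2 beta a k) / r ^+ 2)
             (blocknorm2 beta a k0) ->
  umean (fun x => `|(linform a x <= b)%R%:R - threshold b s (linform a x)|) <= 3 / r.
Proof.
move=> r0 s0 rT Tk0 k0T sE.
apply: (@le_trans _ _ (umean (fun x => (`|linform a x - b| <= s)%R%:R))).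
  by apply: ler_umean => x; exact: ind_threshold.
set P := umean _.
suff : (r * s) * P <= 3 * s.
  by rewrite ler_pdivlMr// mulrAC ler_pM2r// mulrC.
apply: linform_anticoncentration; [exact: ltW|by rewrite mulr_ge0 ?ltW|].
have clamp_sqr_small j : `|a j| <= s -> clamp s (a j) ^+ 2 = a j ^+ 2.
  by move=> h; rewrite clamp_id.
have clamp_sqr_big j : s < `|a j| -> clamp s (a j) ^+ 2 = s ^+ 2.
  rewrite lter_normr => h; case: (clampP (a j) (ltW s0)) => -[-> ?].
  - by case/orP: h => h; lra.
  - by [].
  - by rewrite sqrrN.
have small j : a j ^+ 2 <= s ^+ 2 -> `|a j| <= s.
  by rewrite -[a j ^+ 2]real_normK ?num_real// ler_pXn2r// ?nnegrE// ltW.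
rewrite (sum_over_blocks (beta := beta) _ (T := [set: J])) => [|j]; last by rewrite inE.
have sumT : \sum_(k in [set: J]) \sum_(j | beta j == k) clamp s (a j) ^+ 2 =
    \sum_k \sum_(j | beta j == k) clamp s (a j) ^+ 2.
  by apply: eq_bigl => k; rewrite inE.
rewrite {}sumT exprMn (bigID (mem T))/=.
have inner_ge0 k : 0 <= \sum_(j | beta j == k) clamp s (a j) ^+ 2.
  by apply: sumr_ge0 => j _; exact: sqr_ge0.
move: sE; case: (leP (_ / r ^+ 2)) => hmax sE.
- apply: (@le_trans _ _ (\sum_(k in T) s ^+ 2)).
    by rewrite sumr_const -[_ *+ #|T|]mulr_natl ler_wpM2r ?sqr_ge0.
  rewrite -[leLHS]addr0; apply: lerD; last by apply: sumr_ge0.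
  apply: ler_sum => k kT; case: (pickP [pred j | (beta j == k) && (s < `|a j|)]).
    move=> j /andP[/eqP jk js]; rewrite (bigD1 j) ?jk//= clamp_sqr_big// lerDl.
    by apply: sumr_ge0 => i _; exact: sqr_ge0.
  move=> none; rewrite sE; apply: le_trans (Tk0 k kT) _.
  apply: ler_sum => j jk; rewrite clamp_sqr_small//.
  by have := none j; rewrite /= jk => /negbT; rewrite -leNgt.
- rewrite -[leLHS]add0r; apply: lerD; first by apply: sumr_ge0.
  rewrite sE mulrC divfK ?expf_neq0 ?gt_eqF//.
  rewrite [leLHS](eq_bigl (fun k => k \notin T)) => [|k]; last by rewrite inE.
  apply: ler_sum => k kT; apply: ler_sum => j /eqP jk.
  rewrite clamp_sqr_small//; apply: small; rewrite sE.
  apply: le_trans (ler_blocknorm2 beta a j) _.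
  by rewrite jk; apply: le_trans (k0T k kT) _; exact: ltW.
Qed.

(** The parameters are [t = sqrt m / r], a set [T] of between [r ^ 2] and
    [2 * r ^ 2] heaviest blocks, and the width [s] of [halfspace_threshold]. *)
Lemma ucov_halfspace_ball a b r : #|J| = m -> 2 <= r -> r ^+ 8 <= m%:R ->
  ucov (fun x => (linform a x <= b)%R%:R) iB <= 25 / r.
Proof.
move=> cJ r2 r8; have r0 : 0 < r by lra.
have iB01 x : 0 <= iB x <= 1 by exact: natb_itv.
set q : R := Num.sqrt m%:R; set iA := fun x => _.
have q0 : 0 <= q by rewrite sqrtr_ge0.
have qq : q ^+ 2 = m%:R by rewrite sqr_sqrtr ?ler0n.
have qr4 : r ^+ 4 <= q.
  by rewrite -(ler_pXn2r (n := 2)) ?nnegrE ?exprn_ge0 ?(ltW r0)// qq -exprM.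
have q_gt0 : 0 < q by apply: lt_le_trans qr4; rewrite exprn_gt0.
have r22 : 4 <= r ^+ 2 by rewrite expr2; nra.
have r3 : 8 <= r ^+ 3 by rewrite exprS; nra.
have r4 : 16 <= r ^+ 4 by rewrite exprS; nra.
pose t := q / r.
have t0 : 0 < t by rewrite divr_gt0.
have tr3 : r ^+ 3 <= t by rewrite /t ler_pdivlMr// -exprSr.
have tm : t <= m%:R / 2.
  rewrite /t ler_pdivrMr// -qq expr2.
  have q1 : 1 <= q by lra.
  have : q * (q * r) >= q * (1 * 2) by rewrite ler_pM2l// ler_pM.
  by lra.
have m_gt1 : (1 < m)%N.
  by rewrite -(ltr_nat R); apply: lt_le_trans r8; rewrite (_ : 8 = 2 * 4)%N// exprM; nra.
pose K := (Num.truncn (r ^+ 2)).+1.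
have /andP[Kr rK] := truncn_itv (sqr_ge0 r).
have rK2 : K%:R <= 2 * r ^+ 2.
  by rewrite /K -natr1; lra.
have KJ : (0 < K <= #|J|)%N.
  rewrite /= cJ -(ler_nat R); apply: le_trans rK2 (le_trans _ r8).
  have -> : r ^+ 8 = r ^+ 2 * (r ^+ 2 * r ^+ 4) by rewrite -!exprD.
  by nra.
have [T [k0 [cT k0T Tk0 k0T']]] := exists_top_set (blocknorm2 beta a) KJ.
have Tr : r ^+ 2 <= #|T|%:R by rewrite cT ltW.
have ball : umean (fun x => `|iB x - cutoff t (qform beta m (~: T) x)|) <= 6 / r.
  apply: le_trans (@ball_cutoff t T (2 * r) _ _ _ _ _) _ => //; rewrite ?cJ//.
  - by lra.
  - by rewrite mulr_ge0 ?ltW.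
  - by rewrite cT exprMn; lra.
  rewrite -/q.
  have -> : 5 * t / q = 5 / r by rewrite /t; field; rewrite !gt_eqF.
  have : 2 * r / (2 * t) <= 1 / r.
    rewrite -subr_ge0; have -> : 1 / r - 2 * r / (2 * t) = (q - r ^+ 3) / (r * q).
      by rewrite /t; field; rewrite !gt_eqF.
    rewrite divr_ge0 ?mulr_ge0 ?(ltW r0)// subr_ge0; apply: le_trans qr4.
    by rewrite [leRHS]exprS ler_peMl ?exprn_ge0 ?(ltW r0)//; lra.
  by lra.
have reduce (F : X -> R) : (forall x, 0 <= F x <= 1) -> ucov iA iB <=
    umean (fun x => `|iA x - F x|) + (6 / r +
      `|ucov F (fun x => cutoff t (qform beta m (~: T) x))|).
  move=> F01; rewrite (ucovBl (card_cube_gt0 (I := I)) iA F).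
  apply: lerD; first by apply: le_trans (ler_norm _) _; apply: ler_norm_ucov.
  rewrite ucovC (ucovBl (card_cube_gt0 (I := I)) iB (fun x => cutoff t (qform beta m (~: T) x))).
  apply: lerD; last by rewrite ucovC ler_norm.
  apply: le_trans ball; apply: le_trans (ler_norm _) _; exact: ler_norm_ucov.
set sig := \sum_(k in ~: T) blocknorm2 beta a k.
have sig0 : 0 <= sig by apply: sumr_ge0 => k _; exact: blocknorm2_ge0.
pose S := Num.max (sig / r ^+ 2) (blocknorm2 beta a k0).
have sigS : sig <= S * r ^+ 2.
  by rewrite -ler_pdivrMr ?exprn_gt0// le_max lexx.
have S0 : 0 <= S by rewrite le_max blocknorm2_ge0 orbT.
(* If [S = 0], the linear form lives on the blocks of [T]. *)
move: S0; rewrite le_eqVlt => /orP[/eqP S0|S_gt0].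
  apply: le_trans (reduce iA _) _.
    by move=> x; exact: natb_itv.
  have -> : umean (fun x => `|iA x - iA x|) = 0.
    rewrite -[RHS](umean_cst (card_cube_gt0 (I := I))).
    by apply: eq_umean => x; rewrite subrr normr0.
  have : `|ucov iA (fun x => cutoff t (qform beta m (~: T) x))| <= 0.
    apply: ucov_halfspace_cutoff0 => // k; rewrite inE => kT.
    apply/eqP; rewrite eq_le blocknorm2_ge0 andbT.
    apply: le_trans (k0T' k kT) _.
    by rewrite S0 le_max lexx orbT.
  have : 0 <= 1 / r by rewrite divr_ge0 ?(ltW r0).
  by lra.
pose s := Num.sqrt S.
have s0 : 0 < s by rewrite sqrtr_gt0.
have ss : s ^+ 2 = S by rewrite sqr_sqrtr// ltW.
apply: le_trans (reduce (fun x => threshold b s (linform a x)) _) _.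
  by move=> x; exact: threshold_itv.
have := halfspace_threshold b r0 s0 Tr Tk0 k0T' ss.
have := ucov_threshold_cutoff m_gt0 card_block a b (~: T) s0 t0.
rewrite -/sig ss.
have : 16 * sig / (S * t) <= 16 / r.
  have sr : sig * r <= S * t.
    apply: (@le_trans _ _ (S * r ^+ 3)); last by rewrite ler_pM2l.
    by rewrite exprSr mulrA ler_pM2r.
  rewrite -subr_ge0; have -> : 16 / r - 16 * sig / (S * t) = 16 * (S * t - sig * r) / (r * (S * t)).
    by field; rewrite !gt_eqF.
  have St : 0 <= S * t by rewrite mulr_ge0 ?ltW.
  by apply: divr_ge0; apply: mulr_ge0; rewrite ?subr_ge0 ?(ltW r0).
by rewrite /iA; lra.
Qed.

End Bound.

(** * The noise operator *)

Section Noise.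
Context {R : realType} (n : nat) (t : R).
Implicit Types (f g : cube n -> R) (x y : cube n) (i j : 'I_n).
Local Notation e := (expR (- t)).

Definition noise_kernel (u v : bool) : R := (1 + e * (spin R u * spin R v)) / 2.

Lemma noise1_kernel (u v : bool) :
  noise1 t (fun b => (b == v)%:R) u = noise_kernel u v.
Proof.
rewrite /noise1 /noise_kernel /umean big_bool card_bool /spin.
by case: u; case: v => /=; rewrite ?mulr1n ?mulr0n ?expr1 ?expr0; field.
Qed.

Lemma noiseE f x : noise t f x = \sum_y f y * \prod_i noise_kernel (x i) (y i).
Proof.
apply: eq_bigr => y _; congr (_ * _); apply: eq_bigr => i _.
exact: noise1_kernel.
Qed.

Lemma noise_sym f g :
  umean (fun x => noise t f x * g x) = umean (fun x => f x * noise t g x).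
Proof.
rewrite /umean; congr (_ / _).
transitivity (\sum_x \sum_y f y * g x * \prod_i noise_kernel (x i) (y i)).
  by apply: eq_bigr => x _; rewrite noiseE mulr_suml; apply: eq_bigr => y _; ring.
rewrite exchange_big; apply: eq_bigr => x _ /=.
rewrite noiseE mulr_sumr; apply: eq_bigr => y _.
rewrite -mulrA; congr (_ * (_ * _)); apply: eq_bigr => i _.
by rewrite /noise_kernel [spin R _ * _]mulrC.
Qed.

Lemma noise_sum (K : finType) (c : K -> R) (F : K -> cube n -> R) x :
  noise t (fun y => \sum_k c k * F k y) x = \sum_k c k * noise t (F k) x.
Proof.
rewrite noiseE; under eq_bigr do rewrite mulr_suml.
rewrite exchange_big; apply: eq_bigr => k _ /=.
by rewrite noiseE mulr_sumr; apply: eq_bigr => y _; rewrite mulrA.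
Qed.

Lemma noise_prod (w : 'I_n -> bool -> R) x :
  noise t (fun y => \prod_i w i (y i)) x =
  \prod_i \sum_c w i c * noise_kernel (x i) c.
Proof.
rewrite noiseE bigA_distr_bigA; apply: eq_bigr => y _.
by rewrite -big_split.
Qed.

Lemma noise_spin2 i j x : i != j ->
  noise t (fun y => spin R (y i) * spin R (y j)) x =
  e ^+ 2 * (spin R (x i) * spin R (x j)).
Proof.
move=> ij.
have prod2 (u : 'I_n -> R) : \prod_k (if (k == i) || (k == j) then u k else 1) = u i * u j.
  rewrite (bigD1 i)//= eqxx (bigD1 j) 1?eq_sym//= eqxx orbT big1 ?mulr1// => k.
  by move=> /andP[/negbTE -> /negbTE ->].
pose w k c := if (k == i) || (k == j) then spin R c else 1.
transitivity (noise t (fun y => \prod_k w k (y k)) x).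
  by rewrite !noiseE; apply: eq_bigr => y _; rewrite /w prod2.
rewrite noise_prod.
transitivity (\prod_k if (k == i) || (k == j) then e * spin R (x k) else 1).
  apply: eq_bigr => k _; rewrite big_bool /w /noise_kernel /spin.
  by case: ifP => _; case: (x k) => /=; rewrite ?expr1 ?expr0; field.
by rewrite prod2; ring.
Qed.

End Noise.

(** The expansion into monomials, on which the noise acts diagonally; the squares
    [spin R (x i) ^ 2 = 1] cancel the centring. *)
Lemma qform_spin2 {R : realType} {I J : finType} (beta : I -> J) (m : nat)
    (T : {set J}) (x : {ffun I -> bool}) : (0 < m)%N ->
  (forall k, #|[pred j | beta j == k]| = m) ->
  qform beta m T x = \sum_(p : I * I)
    (if [&& beta p.1 \in T, beta p.2 == beta p.1 & p.2 != p.1] then m%:R^-1 else 0) *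
    (spin R (x p.1) * spin R (x p.2)).
Proof.
move=> m_gt0 card_block.
have m0 : m%:R != 0 :> R by rewrite pnatr_eq0 -lt0n.
rewrite -(pair_bigA _ (fun i j =>
    (if [&& beta i \in T, beta j == beta i & j != i] then m%:R^-1 else 0) *
    (spin R (x i) * spin R (x j))))/=.
transitivity (\sum_(i | beta i \in T) \sum_(j | (beta j == beta i) && (j != i))
    m%:R^-1 * (spin R (x i) * spin R (x j))).
  rewrite (sum_over_blocks (beta := beta) _ (T := T))//; apply: eq_bigr => k kT.
  rewrite expr2 {1}bsumE mulr_suml.
  transitivity (\sum_(i | beta i == k) (m%:R^-1 * (spin R (x i) * bsum beta k x) - m%:R^-1)).
    by rewrite sumrB -mulr_sumr (sum_block_cst card_block) mulfV// [X in X - 1]mulrC.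
  apply: eq_bigr => i /eqP ik; rewrite ik.
  rewrite bsumE (bigD1 i) ?ik//= mulrDr spin_mul_id mulrDr mulr1 addrC addrA addNr add0r.
  by rewrite mulr_sumr mulr_sumr.
rewrite big_mkcond; apply: eq_bigr => i _; case: ifP => iT.
  rewrite big_mkcond; apply: eq_bigr => j _ /=.
  by case: ifP => _; rewrite ?mul0r.
by rewrite big1// => j _; rewrite mul0r.
Qed.

Lemma noise_qform {R : realType} {n : nat} {J : finType} (beta : 'I_n -> J) (m : nat)
    (t : R) (T : {set J}) (x : cube n) : (0 < m)%N ->
  (forall k, #|[pred j | beta j == k]| = m) ->
  noise t (qform beta m T) x = expR (- t) ^+ 2 * qform beta m T x.
Proof.
move=> m_gt0 card_block; pose c (p : 'I_n * 'I_n) : R :=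
  if [&& beta p.1 \in T, beta p.2 == beta p.1 & p.2 != p.1] then m%:R^-1 else 0.
transitivity (noise t (fun y : cube n => \sum_p c p * (spin R (y p.1) * spin R (y p.2))) x).
  by rewrite !noiseE; apply: eq_bigr => y _; rewrite qform_spin2.
rewrite noise_sum qform_spin2// mulr_sumr; apply: eq_bigr => -[i j] _ /=.
rewrite /c/=; have [->|ij] := eqVneq j i; first by rewrite !andbF !mul0r mulr0.
by rewrite noise_spin2 1?eq_sym//; ring.
Qed.

(** The form is homogeneous of degree two, so the noise multiplies it by
    [expR (- t) ^+ 2] and its covariance with the ball survives; up to the sign,
    that covariance is half of its mean absolute value. *)
Lemma uvar_noise_ball {R : realType} {n : nat} {J : finType} (beta : 'I_n -> J)
    (m : nat) (t : R) : (1 < m)%N ->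
  (forall k, #|[pred j | beta j == k]| = m) -> (1600 <= #|J|)%N ->
  expR (- t) ^+ 4 / 3200 <=
    uvar (noise t (fun x : cube n => (qform beta m [set: J] x <= 0 :> R)%R%:R)).
Proof.
move=> m_gt1 card_block J1600; have m_gt0 := ltnW m_gt1.
set f := fun x => _; pose h : cube n -> R := qform beta m [set: J].
set e := expR (- t); set q : R := Num.sqrt #|J|%:R.
have J16 : 1600 <= #|J|%:R :> R by rewrite ler_nat.
have qq : q ^+ 2 = #|J|%:R by rewrite sqr_sqrtr ?ler0n.
have q0 : 0 <= q by rewrite sqrtr_ge0.
have q40 : 40 <= q by rewrite -(ler_pXn2r (n := 2)) ?nnegrE// qq; lra.
have h0 : umean h = 0 by exact: umean_qform.
have h2 : umean (fun x => h x ^+ 2) <= 2 * q ^+ 2.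
  by rewrite qq -cardsT; exact: umean_qform_sqr.
pose P : R := umean (fun x : cube n => (`|h x| <= q / 10)%R%:R).
have PP : P <= 1 / 2.
  have : q * P <= 5 * (q / 10).
    have anti := qform_anticoncentration m_gt0 card_block (T := [set: J]) (s := q / 10) m_gt1.
    rewrite cardsT -/q in anti; apply: anti; first by lra.
    by rewrite -qq expr2; nra.
  by nra.
have abs_h : q / 20 <= umean (fun x => `|h x|).
  (* Markov's inequality at the level [q / 10], which [|h|] exceeds with
     probability at least one half. *)
  have -> : q / 20 = q / 10 * (1 - 1 / 2) by field.
  apply: (@le_trans _ _ (q / 10 * (1 - P))); first by rewrite ler_pM2l; lra.
  have -> : 1 - P = umean (fun x : cube n => 1 - (`|h x| <= q / 10)%R%:R).
    by rewrite umeanB (umean_cst (card_cube_gt0 (I := 'I_n))).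
  rewrite -umeanZ.
  apply: ler_umean => x; case: (leP `|h x|) => hx; rewrite ?mulr1n ?mulr0n.
    by rewrite subrr mulr0.
  by rewrite subr0 mulr1 ltW.
have fh : umean (fun x => f x * h x) = - (2^-1 * umean (fun x => `|h x|)).
  transitivity (umean (fun x => 2^-1 * (h x - `|h x|))).
    apply: eq_umean => x; rewrite /f -/(h x).
    by case: (leP (h x) 0) => hx; rewrite ?mulr1n ?mulr0n ?(ler0_norm hx) ?(gtr0_norm hx); field.
  by rewrite umeanZ umeanB h0; ring.
have cross : umean (fun x => (noise t f x - umean (noise t f)) * h x) =
    e ^+ 2 * umean (fun x => f x * h x).
  transitivity (umean (fun x => noise t f x * h x - umean (noise t f) * h x)).
    by apply: eq_umean => x; rewrite mulrBl.
  rewrite umeanB umeanZ h0 mulr0 subr0 noise_sym -umeanZ.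
  by apply: eq_umean => x; rewrite noise_qform// -/(h x) -/e; ring.
have := umean_CauchySchwarz (fun x => noise t f x - umean (noise t f)) h.
rewrite cross fh; set a := umean _ in abs_h *.
set V := umean (fun x => (_ - _) ^+ 2).
have -> : uvar (noise t f) = V by apply: eq_umean => x; rewrite expr2.
have V0 : 0 <= V by apply: umean_ge0 => x; exact: sqr_ge0.
move=> CS; have : (e ^+ 2 * - (2^-1 * a)) ^+ 2 <= V * (2 * q ^+ 2).
  by apply: le_trans CS _; rewrite ler_wpM2l.
have -> : (e ^+ 2 * - (2^-1 * a)) ^+ 2 = e ^+ 4 * (a ^+ 2 / 4) by field.
have aq : (q / 20) ^+ 2 <= a ^+ 2 by rewrite ler_pXn2r ?nnegrE//; lra.
have e4 : 0 <= e ^+ 4 by rewrite exprn_ge0 ?expR_ge0.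
move=> bound.
have : e ^+ 4 * ((q / 20) ^+ 2 / 4) <= V * (2 * q ^+ 2).
  by apply: le_trans bound; rewrite ler_wpM2l// ler_pM2r ?invr_gt0.
have -> : e ^+ 4 * ((q / 20) ^+ 2 / 4) = e ^+ 4 / 3200 * (2 * q ^+ 2) by field.
by rewrite ler_pM2r// mulr_gt0// exprn_gt0//; lra.
Qed.

(** * The block ball *)

Section BlockBall.
Context {R : realType} (m : nat).
Context (m_gt0 : (0 < m)%N).

Lemma block_subproof (j : 'I_(m ^ 2)) : (j %/ m < m)%N.
Proof. by rewrite ltn_divLR// -mulnn. Qed.

Definition block (j : 'I_(m ^ 2)) : 'I_m := Ordinal (block_subproof j).

Lemma block_eq j (k : 'I_m) : (block j == k) = (k * m <= j < k.+1 * m)%N.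
Proof. by rewrite -val_eqE/= eqn_leq leq_divRL// -ltnS ltn_divLR// andbC. Qed.

Lemma card_block k : #|[pred j | block j == k]| = m.
Proof.
rewrite -sum1_card (eq_bigl (fun j : 'I_(m ^ 2) => (k * m <= j < k.+1 * m)%N)); last first.
  by move=> j; rewrite -block_eq.
rewrite -(big_mkord (fun j => k * m <= j < k.+1 * m)%N (fun=> 1%N)).
rewrite (eq_bigl (fun j => (k * m <= j)%N && (j < k.+1 * m)%N))//.
rewrite -big_nat_widen ?[(m ^ 2)%N]expnS ?expn1 ?leq_pmul2r ?ltn_ord//.
rewrite -(big_nat_widenl (k * m) 0 _ predT)//.
by rewrite sum_nat_const_nat muln1 mulSn addnK.
Qed.

Lemma mem_block_ball (x : cube (m ^ 2)) :
  (x \in block_ball R m) = (qform block m [set: 'I_m] x <= 0 :> R).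
Proof.
have mR0 : m%:R != 0 :> R by rewrite pnatr_eq0 -lt0n.
rewrite inE -subr_le0; congr (_ <= _).
rewrite /qform sumrB sumr_const cardsT card_ord; congr (_ - _).
rewrite [RHS](eq_bigl predT) => [|k]; last by rewrite inE.
apply: eq_bigr => k _; rewrite exprMn exprVn sqr_sqrtr ?ler0n// mulrC; congr (_ ^+ 2 / _).
by rewrite bsumE; apply: eq_bigl => j; rewrite block_eq.
Qed.

End BlockBall.

Lemma noise_stable_block_ball {R : realType} :
  noise_stable R (fun k : nat => block_ball R k.+1).
Proof.
move=> /(_ 1 ltr01) /cvgr0_norm_lt sens.
pose c : R := expR (- 1) ^+ 4 / 3200.
have c0 : 0 < c by apply: divr_gt0; [apply/exprn_gt0/expR_gt0|rewrite ltr0n].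
have [N _ HN] := sens c c0.
have [k Nk k1600] : exists2 k, (N <= k)%N & (1600 <= k)%N.
  by exists (maxn N 1600); rewrite ?leq_maxl ?leq_maxr.
have := HN k Nk; apply/negP; rewrite -leNgt /=.
have m_gt0 := ltn0Sn k.
apply: le_trans (ler_norm _).
have -> : ind R (block_ball R k.+1) =
    (fun x => (qform (block m_gt0) k.+1 [set: 'I_k.+1] x <= 0 :> R)%R%:R).
  by apply/funext => x; rewrite /ind mem_block_ball.
apply: uvar_noise_ball; [|exact: card_block|].
  by rewrite ltnS; apply: leq_trans k1600.
by rewrite card_ord; apply: leq_trans k1600 _.
Qed.

Theorem proposition1p2 (R : realType) :
  noise_stable R (fun k : nat => block_ball R k.+1) /\
  exists C : R, forall m : nat, (1 <= m)%N ->
    max_halfspace_cov R (block_ball R m) <= C * m%:R `^ (- (1 / 200)).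
Proof.
split; first exact: noise_stable_block_ball.
exists 25 => m m_gt0; rewrite powRN; set r := m%:R `^ (1 / 200).
have m1 : 1 <= m%:R :> R by rewrite ler1n.
have r0 : 0 < r by rewrite powR_gt0 ?ltr0n.
have r8 : r ^+ 8 <= m%:R.
  rewrite -powR_mulrn ?(ltW r0)// -powRrM -[leRHS]powRr1 ?ler0n//.
  by apply: ler_powR => //; lra.
apply: ge_sup.
  pose A0 := [set x : cube (m ^ 2) |
    \sum_(i < m ^ 2) spin R (x i) * (0 : 'rV[R]_(m ^ 2)) 0 i <= 0]%SET.
  by exists (ucov (ind R A0) (ind R (block_ball R m))); exists A0 => //; exists 0, 0.
move=> _ [_ [a [b ->]] <-].
(* For [r < 2] the bound exceeds 1, which bounds every covariance of
   indicators. *)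
case: (leP 2 r) => r2; last first.
  apply: (@le_trans _ _ 1); last by rewrite -/(25 / r) ler_pdivlMr//; lra.
  apply: le_trans (ler_norm _) _.
  apply: le_trans (ler_norm_ucov (card_cube_gt0 (I := 'I_(m ^ 2))) _ _) _.
    by move=> x; exact: natb_itv.
  rewrite -[leRHS](umean_cst (card_cube_gt0 (I := 'I_(m ^ 2)))); apply: ler_umean => x.
  by rewrite /ind; case: (_ \in _); rewrite ?normr1 ?normr0.
have -> : ind R (block_ball R m) =
    (fun x => (qform (block m_gt0) m [set: 'I_m] x <= 0 :> R)%R%:R).
  by apply/funext => x; rewrite /ind mem_block_ball.
have -> : ind R [set x : cube (m ^ 2) | \sum_(i < m ^ 2) spin R (x i) * a 0 i <= b]%SET =
    (fun x => (linform (a 0) x <= b)%R%:R).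
  by apply/funext => x; rewrite /ind inE.
by apply: ucov_halfspace_ball; rewrite ?card_ord//; exact: card_block.
Qed.
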